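(* Let $(\Gamma,Z_p,\Omega_p)$ be a framed, miniversal variation of finite, uncoupled, integral BPS structures over a complex manifold $M$. For a ray $r\subset\mathbb{C}^*$ consider the family of functions, for $\beta\in\Gamma$, $p\in M$ such that $r$ is non-active for $(\Gamma,Z_p,\Omega_p)$, and $t\in\mathbb{H}_r$, $$Y_{r,\beta}(p,t)=\prod_{Z_p(\gamma)\in i\mathbb{H}_r}\Lambda\Big(\frac{Z_p(\gamma)}{2\pi i t}\Big)^{\Omega_p(\gamma)\langle\beta,\gamma\rangle},$$ which is the family of solutions to the Riemann-Hilbert problems associated to the structures $(\Gamma,Z_p,\Omega_p)$ (for constant terms $\xi$ taking the value $1$ on all active classes). Then the function $$\tau_r(p;t)=\prod_{Z_p(\gamma)\in i\mathbb{H}_r}\Upsilon\Big(\frac{Z_p(\gamma)}{2\pi i t}\Big)^{\Omega_p(\gamma)}$$ is a $\tau$-function for this family of solutions. (Both products are over the finitely many $\gamma\in\Gamma$ with $\Omega_p(\gamma)\neq0$ and $Z_p(\gamma)\in i\mathbb{H}_r$.)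
   Context: **BPS structures.** A BPS structure $(\Gamma,Z,\Omega)$ consists of a finite-rank free abelian group $\Gamma$ with a skew-symmetric form $\langle-,-\rangle:\Gamma\times\Gamma\to\mathbb{Z}$, a group homomorphism $Z:\Gamma\to\mathbb{C}$, and a map of sets $\Omega:\Gamma\to\mathbb{Q}$, such that $\Omega(-\gamma)=\Omega(\gamma)$ for all $\gamma$, and (support property) for a fixed norm $\|\cdot\|$ on $\Gamma\otimes_{\mathbb{Z}}\mathbb{R}$ there is $C>0$ such that $\Omega(\gamma)\neq0$ implies $|Z(\gamma)|>C\|\gamma\|$. A class is active if $\Omega(\gamma)\ne0$. $\mathrm{DT}(\gamma)=\sum_{\gamma=m\alpha}\frac1{m^2}\Omega(\alpha)$ (sum over integers $m>0$ dividing $\gamma$ in $\Gamma$). The structure is finite if there are only finitely many active classes; uncoupled if $\langle\gamma_1,\gamma_2\rangle=0$ for any two active classes; integral if all $\Omega(\gamma)\in\mathbb{Z}$. A ray is $\ell=\mathbb{R}_{>0}z\subset\mathbb{C}^*$; it is active if it contains $Z(\gamma)$ for some active $\gamma$; its height is $\inf\{|Z(\gamma)|:Z(\gamma)\in\ell,\ \Omega(\gamma)\ne0\}$. For a ray $r$, $\mathbb{H}_r=\{zv:z\in r,\ \mathrm{Re}(v)>0\}$. **Groups for the wall-crossing formula.** Let $\mathbb{C}[\mathbb{T}]=\bigoplus_{\gamma\in\Gamma}\mathbb{C}\,x_\gamma$ with $x_{\gamma_1}x_{\gamma_2}=(-1)^{\langle\gamma_1,\gamma_2\rangle}x_{\gamma_1+\gamma_2}$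 and $\{x_\alpha,x_\beta\}=\langle\alpha,\beta\rangle x_\alpha x_\beta$. For an acute sector $\Delta\subset\mathbb{C}^*$ and $C>0$, let $\Gamma(\Delta,C)\subset\Gamma$ be the submonoid of non-negative integral combinations of elements $\gamma$ with $Z(\gamma)\in\Delta$ and $|Z(\gamma)|>C\|\gamma\|$, and let $\mathbb{C}_{(\Delta,C)}[\mathbb{T}]=\bigoplus_{\gamma\in\Gamma(\Delta,C)}\mathbb{C}x_\gamma$. For $N>0$ let $\mathbb{C}_{(\Delta,C)}[\mathbb{T}]_{<N}$ be its quotient by the Poisson ideal spanned by the $x_\gamma$ with $|Z(\gamma)|\ge N$. The span of the $x_\gamma$ with $\gamma\neq 0$ in this quotient is a nilpotent Lie algebra under the Poisson bracket; $\hat G_{(\Delta,C),<N}$ is the associated unipotent group, i.e. the set of symbols $\exp(x)$ for $x$ in this Lie algebra, with product given by the Baker-Campbell-Hausdorff formula. For a ray $\ell\subset\Delta$, $\mathbb{S}(\ell)^*_{<N}=\exp(\mathrm{DT}(\ell)_{<N})$, where $\mathrm{DT}(\ell)_{<N}=-\sum_{Z(\gamma)\in\ell,\,|Z(\gamma)|<N}\mathrm{DT}(\gamma)x_\gamma$. **Variations.** A framed variation of BPS structures $(\Gamma,Z_p,\Omega_p)$ over a complex manifold $M$ is a family of BPS structures indexed by $p\in M$ with fixed lattice $\Gamma$ and fixed form $\langle-,-\rangle$ (i.e. the local system of charge lattices is trivial) such that: - for each $\gamma\in\Gamma$, $Z_p(\gamma)$ is a holomorphic function of $p$; - for any compact $F\subset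 M$ there is $C>0$ such that $\Omega_p(\gamma)\neq0$ for some $p\in F$ implies $|Z_p(\gamma)|>C\|\gamma\|$; - (wall-crossing formula) for any contractible open $U\subset M$, $N>0$ and acute sector $\Delta$, with $C>0$ a constant as in the previous condition, if the subset $\{\gamma\in\Gamma:Z_p(\gamma)\in\Delta,\ C\|\gamma\|<|Z_p(\gamma)|<N\}$ is constant for $p\in U$, then the clockwise product $\prod_{\ell\subset\Delta}\mathbb{S}_p(\ell)^*_{<N}\in\hat G_{(\Delta,C),<N}$ (over the finitely many rays of height $<N$) is constant for $p\in U$. It is miniversal if the period map $M\to\mathrm{Hom}_{\mathbb{Z}}(\Gamma,\mathbb{C})$, $p\mapsto Z_p$, is a local isomorphism; then for a basis $(\gamma_1,\dots,\gamma_n)$ of $\Gamma$ the functions $z_i=Z_p(\gamma_i)$ are local co-ordinates on $M$. It is a variation of finite, uncoupled, integral structures if each $(\Gamma,Z_p,\Omega_p)$ has these properties. **$\tau$-functions.** Given functions $Y_{r,\beta}(p,t)$ as in the claim, a $\tau$-function for the family is a $\mathbb{C}^*$-valued function $\tau_r(p;t)$ which is piecewise holomorphic (holomorphic, for $t\in\mathbb{H}_r$, away from points $p$ at which the ray $r$ is active), is invariant under simultaneous rescaling of $Z$ and $t$ (that is, its value is unchanged under $(Z,t,r)\mapsto(\lambda Z,\lambda t,\lambda r)$ for $\lambda\in\mathbb{C}^*$), and satisfies, for a basis $(\gamma_1,\dots,\gamma_n)$ of $\Gamma$ and all $j$, $$\frac1{2\pi i}\,\frac{\partial\log Y_{r,\gamma_j}}{\partial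 t}=\sum_i\epsilon_{ij}\,\frac{\partial\log\tau_r}{\partial z_i},\qquad \epsilon_{ij}=\langle\gamma_i,\gamma_j\rangle.$$ **Special functions** on $\mathbb{C}^*\setminus\mathbb{R}_{<0}$, with powers defined by the principal branch of $\log$: $$\Lambda(w)=\frac{e^w\,\Gamma(w)}{\sqrt{2\pi}\,w^{w-\frac12}},\qquad \Upsilon(w)=\frac{e^{-\zeta'(-1)}\,e^{\frac34w^2}\,G(w+1)}{(2\pi)^{w/2}\,w^{w^2/2}},$$ where $\Gamma(w)$ is the gamma function, $G$ is the Barnes $G$-function and $\zeta$ the Riemann zeta function. *)

(* Defs.v *)
From HB Require Import structures.
From mathcomp Require Import all_boot all_order all_algebra.
From mathcomp Require Import finmap complex.
From mathcomp Require Import all_classical all_reals all_analysis.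
Set Implicit Arguments.
Unset Strict Implicit.
Unset Printing Implicit Defensive.
Import Order.TTheory GRing.Theory Num.Theory numFieldNormedType.Exports.
Local Open Scope classical_set_scope.
Local Open Scope complex_scope.
Local Open Scope ring_scope.

(* Topology and norm of R[i]: those of a numFieldType over itself, so that
   differentiability over R[i] is complex differentiability. *)
HB.instance Definition _ (R : rcfType) := NormedModule.copy R[i] R[i]^o.

Section ComplexFunctions.
Variable R : realType.
Local Notation C := R[i].
Implicit Types (w z s : C).

Definition cmod z : R := complex.Re `|z|.

Definition cis (x : R) : C := cos x +i* sin x.

Definition cexp z : C := (expR (complex.Re z))%:C * cis (complex.Im z).

(* the argument in ]-pi, pi] *)
Definition carg z : R :=
  if 0 <= complex.Im z then acos (complex.Re z / cmod z)
  else - acos (complex.Re z / cmod z).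

Definition clog z : C := ln (cmod z) +i* carg z.

Definition cpow z s : C := cexp (s * clog z).

Definition holomorphic_at (V W : normedModType C) (f : V -> W) (x : V) : Prop :=
  \forall y \near x, differentiable f y.

(* Analytic continuation of \sum_(k >= 1) k^-s to the complement of 1; it is
   unique there, and the (irrelevant) value at 1 is left unspecified. *)
Definition riemann_zeta : C -> C :=
  xget (fun=> 0) [set f : C -> C |
    (forall s, s != 1 -> holomorphic_at f s) /\
    (forall s, 1 < complex.Re s ->
      (\sum_(1 <= k < m.+1) cpow k%:R (- s)) @[m --> \oo] --> f s)].

Definition euler_gamma : R :=
  lim ((\sum_(1 <= k < m.+1) (k%:R : R)^-1 - ln m%:R) @[m --> \oo]).

(* Gamma and the Barnes G-function are given by their Weierstrass products. *)
Definition Gamma_fun w : C :=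
  cexp (- euler_gamma%:C * w) / w *
  lim ((\prod_(1 <= k < m.+1) ((1 + w / k%:R)^-1 * cexp (w / k%:R)))
         @[m --> \oo]).

Definition barnesG z : C :=
  let w := z - 1 in
  cpow (2 * pi)%:C (w / 2) *
  cexp (- (w + w ^+ 2 * (1 + euler_gamma%:C)) / 2) *
  lim ((\prod_(1 <= k < m.+1)
          ((1 + w / k%:R) ^+ k * cexp (w ^+ 2 / (2 * k%:R) - w)))
         @[m --> \oo]).

Definition Lambda w : C :=
  cexp w * Gamma_fun w / ((Num.sqrt (2 * pi))%:C * cpow w (w - 1 / 2)).

Definition Upsilon w : C :=
  cexp (- derive1 riemann_zeta (-1)) * cexp (3 / 4 * w ^+ 2) * barnesG (w + 1)
  / (cpow (2 * pi)%:C (w / 2) * cpow w (w ^+ 2 / 2)).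

Definition ray_of z : set C := [set w | exists x : R, 0 < x /\ w = x%:C * z].

Definition is_ray (r : set C) : Prop := exists z, z != 0 /\ r = ray_of z.

Definition half_plane (r : set C) : set C :=
  [set w | exists z v, [/\ r z, 0 < complex.Re v & w = z * v]].

Definition dilate (l : C) (S : set C) : set C := [set l * z | z in S].

(* the union of the rays of direction cis x for x in I *)
Definition sector (I : interval R) : set C :=
  [set z | exists2 x, x \in I & ray_of (cis x) z].

End ComplexFunctions.

Record chart (R : realType) (M : Type) (d : nat) := Chart {
  cdom : set M;
  cfun : M -> 'rV[R[i]]_d;
  cinv : 'rV[R[i]]_d -> M }.

Definition is_chart (R : realType) (M : topologicalType) (d : nat)
    (c : chart R M d) : Prop :=
  [/\ open (cdom c), open (cfun c @` cdom c),
      forall q, cdom c q -> cinv c (cfun c q) = q,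
      forall q, cdom c q -> {for q, continuous (cfun c)} &
      forall x, (cfun c @` cdom c) x -> {for x, continuous (cinv c)}].

Record complexManifold (R : realType) := ComplexManifold {
  mcarrier :> topologicalType;
  mdim : nat;
  atlas : set (chart R mcarrier mdim);
  manifold_hausdorff : hausdorff_space mcarrier;
  manifold_second_countable : @second_countable mcarrier;
  atlas_chart : forall c, atlas c -> is_chart c;
  atlas_cover : forall q, exists c, atlas c /\ cdom c q;
  atlas_compatible : forall c1 c2 q, atlas c1 -> atlas c2 ->
    cdom c1 q -> cdom c2 q ->
    holomorphic_at (cfun c2 \o cinv c1) (cfun c1 q) }.

Section Manifolds.
Variables (R : realType) (M : complexManifold R).
Local Notation C := R[i].

Definition mholo (W : normedModType C) (f : M -> W) (p : M) : Prop :=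
  forall c, atlas c -> cdom c p -> holomorphic_at (f \o cinv c) (cfun c p).

Definition mholo2 (f : M -> C -> C) (p : M) (t : C) : Prop :=
  forall c, atlas c -> cdom c p ->
    holomorphic_at (fun u : 'rV[C]_(mdim M) * C => f (cinv c u.1) u.2)
      (cfun c p, t).

Definition holo_into (W : normedModType C) (f : W -> M) (x : W) : Prop :=
  {for x, continuous f} /\
  forall c, atlas c -> cdom c (f x) -> holomorphic_at (cfun c \o f) x.

(* f restricts to a biholomorphism from a neighbourhood of p onto an open
   subset of W, with inverse s *)
Definition local_inverse (W : normedModType C) (f : M -> W) (p : M)
    (s : W -> M) : Prop :=
  exists (A : set M) (B : set W),
    [/\ open A, open B, A p,
        forall q, A q -> [/\ B (f q), s (f q) = q & mholo f q] &
        forall x, B x -> [/\ A (s x), f (s x) = x & holo_into s x]].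

Definition local_isomorphism (W : normedModType C) (f : M -> W) : Prop :=
  forall p, exists s, local_inverse f p s.

Definition contractible (A : set M) : Prop :=
  exists (a : M) (H : M * R -> M),
    [/\ A a, {within A `*` `[0, 1], continuous H},
        forall x s, A x -> 0 <= s <= 1 -> A (H (x, s)) &
        forall x, A x -> H (x, 0) = x /\ H (x, 1) = a].

End Manifolds.

(* Charge lattice: a free abelian group L with basis g, a skew form, and a norm
   on L (x) R, which the basis identifies with R^n. *)
Definition zbasis (L : zmodType) (n : nat) (g : 'I_n -> L) : Prop :=
  forall a : L, exists! m : 'rV[int]_n, a = \sum_(i < n) g i *~ m 0 i.

Definition skew_form (L : zmodType) (form : L -> L -> int) : Prop :=
  (forall a b c, form (a + b) c = form a c + form b c) /\
  (forall a b, form a b = - form b a).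

Definition is_norm (R : realType) (n : nat) (N : 'rV[R]_n -> R) : Prop :=
  [/\ forall x, 0 <= N x, forall x, N x = 0 -> x = 0,
      forall (a : R) x, N (a *: x) = `|a| * N x &
      forall x y, N (x + y) <= N x + N y].

Definition lcoord (L : zmodType) (n : nat) (g : 'I_n -> L) (a : L) :
    'rV[int]_n :=
  xget 0 [set m : 'rV[int]_n | a = \sum_(i < n) g i *~ m 0 i].

Definition lnorm (R : realType) (L : zmodType) (n : nat) (g : 'I_n -> L)
    (N : 'rV[R]_n -> R) (a : L) : R :=
  N (map_mx (fun k : int => k%:~R) (lcoord g a)).

(* the pair (Z, Omega) *)
Record bps (R : realType) (L : zmodType) := Bps {
  Zch : {additive L -> R[i]};
  Omega : L -> rat }.

Section BPS.
Variables (R : realType) (L : zmodType) (n : nat) (g : 'I_n -> L).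
Variables (form : L -> L -> int) (N : 'rV[R]_n -> R).
Local Notation C := R[i].
Implicit Types (B : bps R L) (r : set C).

Definition active B : set L := [set a | Omega B a != 0].

Definition support_bound B (K : R) : Prop :=
  forall a, active B a -> K * lnorm g N a < cmod (Zch B a).

Definition is_bps B : Prop :=
  (forall a, Omega B (- a) = Omega B a) /\
  (exists K : R, 0 < K /\ support_bound B K).

Definition finite_bps B : Prop := finite_set (active B).

Definition uncoupled_bps B : Prop :=
  forall a b, active B a -> active B b -> form a b = 0.

Definition integral_bps B : Prop := forall a, Omega B a \is a Num.int.

Definition active_ray B r : Prop := exists a, active B a /\ r (Zch B a).

Definition ray_height B r : \bar R :=
  ereal_inf [set (cmod (Zch B a))%:E |
               a in [set a | active B a /\ r (Zch B a)]].

Definition DT B (a : L) : rat :=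
  \sum_(x \in [set x : nat * L | (0 < x.1)%N /\ a = x.2 *+ x.1])
    (Omega B x.2 / x.1%:R ^+ 2).

Definition rescale (l : C) B : bps R L := Bps (l \*o Zch B) (Omega B).

(* In the Lie algebras and unipotent groups of the wall-crossing formula, an
   element \sum_a f(a) x_a is encoded by its coefficient function f, and
   exp(x) by x. *)

Definition truncate (S : set L) (f : L -> C) : L -> C := patch (fun=> 0) S f.

(* the generators of Gamma(Delta, K) *)
Definition sector_gens B (D : set C) (K : R) : set L :=
  [set a | D (Zch B a) /\ K * lnorm g N a < cmod (Zch B a)].

Definition sector_monoid B (D : set C) (K : R) : set L :=
  [set a | exists s : seq L,
     (forall x, x \in s -> sector_gens B D K x) /\ a = \sum_(x <- s) x].

Definition lie_support B (D : set C) (K T : R) : set L :=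
  [set a | [/\ sector_monoid B D K a, a != 0 & cmod (Zch B a) < T]].

(* {x_a, x_b} = <a, b> (-1)^<a, b> x_(a + b), modulo the x_c with c not in S *)
Definition lie_bracket (S : set L) (f h : L -> C) : L -> C :=
  truncate S (fun c => \sum_(a \in [set: L])
    ((form a (c - a))%:~R * (-1) ^ form a (c - a) * (f a * h (c - a)))).

(* [w1, [w2, ... [w_(m-1), w_m]]] *)
Fixpoint nested_bracket (br : (L -> C) -> (L -> C) -> (L -> C))
    (w : seq (L -> C)) : L -> C :=
  match w with
  | [::] => 0
  | [:: x] => x
  | x :: w' => br x (nested_bracket br w')
  end.

(* Dynkin's form of the Baker-Campbell-Hausdorff series log(exp X exp Y):
   the sum over k >= 0 and (r_i, s_i)_(i <= k), r_i + s_i > 0, of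
   (-1)^k / (k + 1) [X^r_0 Y^s_0 ... X^r_k Y^s_k]
      / (\sum_i (r_i + s_i) \prod_i r_i! s_i!),
   here restricted to k < m and r_i, s_i <= m. *)
Definition bch_partial (br : (L -> C) -> (L -> C) -> (L -> C)) (X Y : L -> C)
    (m : nat) : L -> C :=
  \sum_(k < m)
  \sum_(e : {ffun 'I_k.+1 -> 'I_m.+1 * 'I_m.+1}
          | [forall i, 0 < (e i).1 + (e i).2]%N)
    ((-1) ^+ k / k.+1%:R
      / ((\sum_i ((e i).1 + (e i).2)) * (\prod_i ((e i).1`! * (e i).2`!)))%N%:R)
    *: nested_bracket br
         (flatten [seq nseq (e i).1 X ++ nseq (e i).2 Y | i <- enum 'I_k.+1]).

(* For a nilpotent bracket the partial sums are eventually constant. *)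
Definition bch (br : (L -> C) -> (L -> C) -> (L -> C)) (X Y : L -> C) : L -> C :=
  fun a => lim (bch_partial br X Y m a @[m --> \oo]).

(* log S(l)^*_(< T) *)
Definition DT_ray B r (T : R) : L -> C :=
  truncate [set a | r (Zch B a) /\ cmod (Zch B a) < T]
    (fun a => - ratr (DT B a)).

(* the directions in I of the rays of height < T, in clockwise order *)
Definition ray_angles B (I : interval R) (T : R) : seq R :=
  sort (fun x y => y <= x)
    (fset_set [set x | x \in I /\ (ray_height B (ray_of (cis x)) < T%:E)%E]).

Definition clockwise_product B (I : interval R) (K T : R) : L -> C :=
  foldr (bch (lie_bracket (lie_support B (sector I) K T))) 0
    [seq DT_ray B (ray_of (cis x)) T | x <- ray_angles B I T].

(* the active classes with Z(a) in i HH_r *)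
Definition right_classes B r : set L :=
  [set a | active B a /\ dilate 'i (half_plane r) (Zch B a)].

(* numq reads off the integer Omega(a) of an integral structure. *)
Definition Y_fun B r (b : L) (t : C) : C :=
  \big[*%R/1]_(a \in right_classes B r)
    Lambda (Zch B a / (2 * pi%:C * 'i * t)) ^ (numq (Omega B a) * form b a).

Definition tau_fun B r (t : C) : C :=
  \big[*%R/1]_(a \in right_classes B r)
    Upsilon (Zch B a / (2 * pi%:C * 'i * t)) ^ numq (Omega B a).

Section Variations.
Variables (M : complexManifold R) (V : M -> bps R L).

(* An acute sector has an opening < pi/2, so that |Z(a + b)| >= |Z(a)| and the
   x_c with |Z(c)| >= T span an ideal; the booleans say which of its two
   boundary rays it contains. *)
Definition wall_crossing : Prop :=
  forall (A : set M) (K T a b : R) (ca cb : bool),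
    open A -> contractible A -> 0 < K -> 0 < T ->
    (forall p, A p -> support_bound (V p) K) ->
    a < b -> b - a < pi / 2 ->
    let I := Interval (BSide ca a) (BSide cb b) in
    (forall p q, A p -> A q ->
      [set c | sector_gens (V p) (sector I) K c /\ cmod (Zch (V p) c) < T] =
      [set c | sector_gens (V q) (sector I) K c /\ cmod (Zch (V q) c) < T]) ->
    forall p q, A p -> A q ->
      clockwise_product (V p) I K T = clockwise_product (V q) I K T.

Definition framed_variation : Prop :=
  [/\ forall p, is_bps (V p),
      forall (c : L) p, mholo (fun q => Zch (V q) c) p,
      forall F : set M, compact F ->
        exists K : R, 0 < K /\ forall p, F p -> support_bound (V p) K &
      wall_crossing].

(* the period map, in the coordinates of Hom(L, C) given by the basis g *)
Definition period (p : M) : 'rV[C]_n := \row_i Zch (V p) (g i).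

Definition miniversal : Prop := local_isomorphism period.

(* \partial f / \partial z_i at p, computed through a local inverse of the
   period map; all of them have the same germ at period p. *)
Definition period_inv (p : M) : 'rV[C]_n -> M :=
  xget (fun=> p) [set s | local_inverse period p s].

Definition partial_z (i : 'I_n) (f : M -> C) (p : M) : C :=
  'D_(delta_mx 0 i) (f \o period_inv p) (period p).

(* A tau-function is given as a function tau of the structure, the ray and t,
   with tau_r(p; t) = tau (V p) r t, so that the rescaling of Z makes sense.
   The derivatives of log f are f' / f. *)
Definition is_tau_function (Y : set C -> L -> M -> C -> C)
    (tau : bps R L -> set C -> C -> C) : Prop :=
  forall r, is_ray r -> forall (p : M) (t : C), half_plane r t ->
  [/\ tau (V p) r t != 0,
      ~ active_ray (V p) r -> mholo2 (fun q s => tau (V q) r s) p t,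
      forall l : C, l != 0 ->
        tau (rescale l (V p)) (dilate l r) (l * t) = tau (V p) r t &
      ~ active_ray (V p) r -> forall j : 'I_n,
        [/\ derivable (Y r (g j) p) t 1, Y r (g j) p t != 0 &
          (2 * pi%:C * 'i)^-1 * (derive1 (Y r (g j) p) t / Y r (g j) p t) =
          \sum_(i < n) (form (g i) (g j))%:~R *
            (partial_z i (fun q => tau (V q) r t) p / tau (V p) r t)]].

End Variations.
End BPS.

(* Main.v *)
Require Import Defs.
From mathcomp Require Import all_boot all_order all_algebra.
From mathcomp Require Import finmap complex.
From mathcomp Require Import all_classical all_reals all_analysis.
From mathcomp Require Import ring lra.

(** The statement splits into a fact about the variation and an identity
    between special functions.

    The first is that the BPS invariants are locally constant
    ([Omega_near_constant]). In an uncoupled structure the elements of the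
    wall-crossing Lie algebra that occur commute, so the clockwise product over
    a sector is the exponential of the sum of the DT invariants of the classes
    in the sector ([clockwise_product_uncoupled]), and the wall-crossing
    formula says that DT is constant at each of them. For a class c this is
    applied to a narrow sector around the ray of Z(c), on a small polydisc in
    the period coordinates; by the support property only finitely many classes
    could enter or leave the sector, and generic constants prevent this
    ([near_region]). Moebius inversion passes from DT to Omega
    ([Omega_of_DT]). The polydisc depends on c, but constancy along paths gives a
    neighbourhood that serves for all classes. As r is not active, the central
    charges of the active classes also stay off the boundary of the half-plane
    i H_r. Hence near p the products for Y and tau have a fixed finite set of
    factors, with fixed exponents ([near_right_classes]).

    The second is (log Upsilon)'(w) = w (log Lambda)'(w) on the plane without
    the nonpositive reals ([is_derive_log_Upsilon]). The k-th factors of the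
    products that define G(w + 1) and Gamma(w) have logarithmic derivatives
    w^2 / (k (k + w)) and w / (k (k + w)); the ratio is w for every k. The
    logarithms of the factors are bounded by a multiple of 1 / k^2, and the
    errors of their linear approximations by a multiple of |h|^2 / k^2, so that
    the series of logarithms converges and can be differentiated termwise
    ([sum_derive]). Being exponentials of its sum, the products do not vanish.

    In the coordinates z_i = Z(g_i), the charge Z(a) is linear with the
    coordinates of a as coefficients. Comparing the logarithmic derivatives of
    the factors of a in both products, the identity and the skew symmetry of
    the form give the equation for tau ([tau_equation]). *)

Set Implicit Arguments.
Unset Strict Implicit.
Unset Printing Implicit Defensive.
Import Order.TTheory GRing.Theory Num.Theory numFieldNormedType.Exports.
Local Open Scope classical_set_scope.
Local Open Scope complex_scope.
Local Open Scope ring_scope.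

(** * Complex differentiation *)

(** The epsilon-delta form of differentiability, over real and complex scalars
    alike: it is the passage between the real derivatives of exp, cos and sin
    and complex derivatives. *)
Lemma is_deriveP (K : numFieldType) (f : K -> K) (x d : K) :
  is_derive x 1 f d <->
  forall e : K, 0 < e -> exists2 r : K, 0 < r &
    forall h, `|h| < r -> `|f (h + x) - f x - h * d| <= e * `|h|.
Proof.
have E : forall h : K, h != 0 ->
    `|d - h^-1 *: ((f \o shift x) (h *: (1 : K)) - f x)| =
    `|h|^-1 * `|f (h + x) - f x - h * d|.
  move=> h h0; rewrite -normfV -normrM -normrN opprB mulrBr mulrA mulVf //.
  by rewrite mul1r /= /shift /= [h *: _]mulr1.
split.
  move=> [fd fE] e e0; move: fd; rewrite /derivable => fd.
  have : h^-1 *: ((f \o shift x) (h *: (1 : K)) - f x) @[h --> 0^'] --> d.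
    by rewrite -fE; exact: fd.
  move/cvgrPdist_lt/(_ e e0); rewrite near_withinE => /nbhs_normP[r /= r0 rP].
  exists r => // h hr.
  have [->|h0] := eqVneq h 0.
    by rewrite add0r subrr mul0r subrr normr0 mulr0.
  have := rP h; rewrite /= sub0r normrN => /(_ hr h0).
  rewrite E // mulrC => /ltW.
  by rewrite ler_pdivrMr // normr_gt0.
move=> H.
have cv : h^-1 *: ((f \o shift x) (h *: (1 : K)) - f x) @[h --> 0^'] --> d.
  apply/cvgrPdist_le => e e0; have [r r0 rP] := H e e0.
  rewrite near_withinE; apply/nbhs_normP; exists r => //= h /=.
  rewrite sub0r normrN => hr h0; rewrite E // mulrC ler_pdivrMr ?normr_gt0 //.
  exact: rP.
apply: DeriveDef.
  by apply/cvg_ex; exists d.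
by apply/cvg_lim => //; apply: norm_hausdorff.
Qed.

Section ComplexBasics.
Variable R : realType.
Local Notation C := R[i].
Implicit Types (w z : C).

Lemma cmodE z : `|z| = (cmod z)%:C.
Proof. by rewrite /cmod normc_def. Qed.

Lemma cmod_def z : cmod z = Num.sqrt (complex.Re z ^+ 2 + complex.Im z ^+ 2).
Proof. by rewrite /cmod normc_def. Qed.

Lemma cmod_ge0 z : 0 <= cmod z.
Proof. by rewrite cmod_def sqrtr_ge0. Qed.

Lemma cmodD w z : cmod (w + z) <= cmod w + cmod z.
Proof. by rewrite -lecR rmorphD -!cmodE ler_normD. Qed.

Lemma cmodM w z : cmod (w * z) = cmod w * cmod z.
Proof. by apply: (@complexI R); rewrite rmorphM -!cmodE normrM. Qed.

Lemma cmodN z : cmod (- z) = cmod z.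
Proof. by apply: (@complexI R); rewrite -!cmodE normrN. Qed.

Lemma cmodB w z : cmod (w - z) = cmod (z - w).
Proof. by rewrite -cmodN opprB. Qed.

Lemma cmodV z : cmod z^-1 = (cmod z)^-1.
Proof. by apply: (@complexI R); rewrite fmorphV -!cmodE normfV. Qed.

Lemma cmod_real (x : R) : cmod x%:C = `|x|.
Proof. by rewrite cmod_def /= expr0n addr0 sqrtr_sqr. Qed.

Lemma cmod0 : cmod (0 : C) = 0.
Proof. by rewrite (cmod_real 0) normr0. Qed.

Lemma cmod1 : cmod (1 : C) = 1.
Proof. by rewrite (cmod_real 1) normr1. Qed.

Lemma natC n : (n%:R : C) = (n%:R : R)%:C.
Proof. by rewrite rmorph_nat. Qed.

Lemma cmod_nat n : cmod (n%:R : C) = n%:R.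
Proof. by rewrite natC cmod_real normr_nat. Qed.

Lemma cmod_eq0 z : (cmod z == 0) = (z == 0).
Proof. by rewrite -(inj_eq (@complexI R)) -cmodE normr_eq0. Qed.

Lemma cmod_gt0 z : (0 < cmod z) = (z != 0).
Proof. by rewrite lt0r cmod_ge0 andbT cmod_eq0. Qed.

Lemma Re_le_cmod z : `|complex.Re z| <= cmod z.
Proof. by rewrite -lecR -cmodE normc_ge_Re. Qed.

Lemma Im_le_cmod z : `|complex.Im z| <= cmod z.
Proof.
rewrite cmod_def -sqrtr_sqr ler_sqrt ?sqr_ge0 //; last by rewrite addr_ge0 ?sqr_ge0.
by rewrite lerDr sqr_ge0.
Qed.

Lemma cmod_le_ReIm z : cmod z <= `|complex.Re z| + `|complex.Im z|.
Proof.
rewrite cmod_def -[leRHS]ger0_norm ?addr_ge0 // -sqrtr_sqr ler_sqrt ?sqr_ge0 //.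
rewrite sqrrD !real_normK ?num_real // lerD2r lerDl mulrn_wge0 //.
Qed.

Lemma cReM w z : complex.Re (w * z) =
  complex.Re w * complex.Re z - complex.Im w * complex.Im z.
Proof. by case: w z => [a b] [c d]. Qed.

Lemma cImM w z : complex.Im (w * z) =
  complex.Re w * complex.Im z + complex.Im w * complex.Re z.
Proof. by case: w z => [a b] [c d] /=. Qed.

Lemma cReD w z : complex.Re (w + z) = complex.Re w + complex.Re z.
Proof. by case: w z => [a b] [c d]. Qed.

Lemma cImD w z : complex.Im (w + z) = complex.Im w + complex.Im z.
Proof. by case: w z => [a b] [c d] /=. Qed.

Lemma cReN z : complex.Re (- z) = - complex.Re z.
Proof. by case: z. Qed.

Lemma cImN z : complex.Im (- z) = - complex.Im z.
Proof. by case: z. Qed.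

Lemma complex_ext w z : complex.Re w = complex.Re z ->
  complex.Im w = complex.Im z -> w = z.
Proof. by case: w z => [a b] [c d] /= -> ->. Qed.

(** A positive element for the order of the complex numbers is a positive
    real, so that neighbourhoods can be described by real radii. *)
Lemma gt0C (e : C) : 0 < e -> exists2 r : R, 0 < r & e = r%:C.
Proof.
rewrite ltcE => /andP[/eqP i0 r0]; exists (complex.Re e) => //.
by apply: complex_ext.
Qed.

Lemma cder (f : C -> C) z d :
  (forall e : R, 0 < e -> exists2 r : R, 0 < r &
    forall h, cmod h < r -> cmod (f (h + z) - f z - h * d) <= e * cmod h) ->
  is_derive z 1 f d.
Proof.
move=> H; apply/is_deriveP => _ /gt0C[e e0 ->]; have [r r0 rP] := H e e0.
exists r%:C; first by rewrite ltcR.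
by move=> h; rewrite !cmodE -rmorphM ltcR lecR; exact: rP.
Qed.

Lemma cderP (f : C -> C) z d : is_derive z 1 f d ->
  forall e : R, 0 < e -> exists2 r : R, 0 < r &
    forall h, cmod h < r -> cmod (f (h + z) - f z - h * d) <= e * cmod h.
Proof.
move=> /is_deriveP H e e0; have [|r' r0 rP] := H e%:C; first by rewrite ltcR.
have [r {}r0 rE] := gt0C r0; exists r => // h hr.
by rewrite -lecR rmorphM -!cmodE; apply: rP; rewrite rE cmodE ltcR.
Qed.

Lemma nbhsC (z : C) (P : set C) : nbhs z P <->
  exists2 r : R, 0 < r & forall w, cmod (w - z) < r -> P w.
Proof.
split.
  move=> /nbhs_normP[e /= /gt0C[r r0 ->]] H; exists r => // w wr; apply: H => /=.
  by rewrite cmodE ltcR cmodB.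
move=> [r r0 H]; apply/nbhs_normP; exists r%:C => /=; first by rewrite ltcR.
by move=> w /=; rewrite cmodE ltcR cmodB => /H.
Qed.

Lemma cvgCP (T : Type) (F : set_system T) (FF : Filter F) (f : T -> C) (l : C) :
  f @ F --> l <->
  forall e : R, 0 < e -> \forall t \near F, cmod (f t - l) < e.
Proof.
split.
  move=> /cvgrPdist_lt H e e0; have := H e%:C; rewrite ltcR => /(_ e0).
  by apply: filterS => t; rewrite cmodE ltcR cmodB.
move=> H; apply/cvgrPdist_lt => _ /gt0C[e e0 ->].
by apply: filterS (H e e0) => t; rewrite cmodE ltcR cmodB.
Qed.

Lemma cvg_ReIm (T : Type) (F : set_system T) (FF : Filter F) (f : T -> C) (l : C) :
  (fun t => complex.Re (f t)) @ F --> complex.Re l ->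
  (fun t => complex.Im (f t)) @ F --> complex.Im l ->
  f @ F --> l.
Proof.
move=> /cvgrPdist_lt Hr /cvgrPdist_lt Hi; apply/cvgCP => e e0.
have e20 : 0 < e / 2 by rewrite divr_gt0.
apply: filterS2 (Hr _ e20) (Hi _ e20) => t ltr lti.
apply: le_lt_trans (cmod_le_ReIm _) _.
by rewrite cReD cImD cReN cImN distrC [in ltLHS](distrC (complex.Im _)) [ltRHS]splitr ltrD.
Qed.

Lemma Re_continuous : continuous (@complex.Re R : C -> R).
Proof.
move=> z; apply/(@cvgrPdist_lt _ _ _ (nbhs z)) => e e0; apply/nbhsC; exists e => // w /=.
by move=> we; rewrite -cReN -cReD; apply: le_lt_trans (Re_le_cmod _) _; rewrite cmodB.
Qed.

Lemma Im_continuous : continuous (@complex.Im R : C -> R).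
Proof.
move=> z; apply/(@cvgrPdist_lt _ _ _ (nbhs z)) => e e0; apply/nbhsC; exists e => // w /=.
by move=> we; rewrite -cImN -cImD; apply: le_lt_trans (Im_le_cmod _) _; rewrite cmodB.
Qed.

Lemma cmod_continuous : continuous (@cmod R : C -> R).
Proof.
move=> z; apply/(@cvgrPdist_lt _ _ _ (nbhs z)) => e e0; apply/nbhsC; exists e => // w /=.
move=> we; apply: le_lt_trans we; rewrite ler_norml; apply/andP; split.
  by rewrite lerNl opprB lerBlDr -[leLHS]/(cmod w) -[in leLHS](subrK z w) cmodD.
by rewrite lerBlDr cmodB -[in leLHS](subrK w z) cmodD.
Qed.

Lemma real_complex_continuous : continuous (fun x : R => x%:C).
Proof.
move=> x; apply/cvgCP => e e0; near=> y.
rewrite -rmorphB cmod_real distrC; near: y.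
by move: e e0; apply/cvgrPdist_lt; exact: cvg_id.
Unshelve. all: by end_near. Qed.

End ComplexBasics.

(** Reduces directional derivatives to derivatives in one variable, where the
    chain rule applies. *)
Lemma is_derive_line (K : numFieldType) (V W : normedModType K) (f : V -> W)
    (x v : V) (d : W) :
  is_derive x v f d <-> is_derive (0 : K) 1 (fun h : K => f (h *: v + x)) d.
Proof.
have E : 'D_v f x = 'D_1 (fun h : K => f (h *: v + x)) 0.
  rewrite /derive; apply: (congr1 (fun F : K -> W => lim (F h @[h --> 0^']))).
  apply/funext => h /=.
  by rewrite /shift /= addr0 scale0r add0r [h *: 1]mulr1.
split=> -[fd fE]; apply: DeriveDef; rewrite -?fE -?E //.
  by apply: (iffLR (derivable1P _ _ _)).
by apply: (iffRL (derivable1P _ _ _)).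
Qed.

Lemma is_derive1_comp_ring (K : numFieldType) (f g : K -> K) (x df dg : K) :
  is_derive x 1 g dg -> is_derive (g x) 1 f df ->
  is_derive x 1 (f \o g) (df * dg).
Proof.
move=> Hg Hf.
have Dg : differentiable g x by apply/derivable1_diffP; case: Hg.
have Df : differentiable f (g x) by apply/derivable1_diffP; case: Hf.
have D : differentiable (f \o g) x by apply: differentiable_comp.
apply: DeriveDef; first exact/derivable1_diffP.
rewrite deriveE // diff_comp //= -[X in 'd f _ X]mulr1 -[_ * 1]/(_ *: 1).
rewrite linearZ /= -!deriveE //.
by have [_ ->] := Hf; have [_ ->] := Hg; rewrite [LHS]mulrC.
Qed.

Lemma is_derive_comp (K : numFieldType) (V : normedModType K) (f : K -> K)
    (g : V -> K) (x v : V) (df dg : K) :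
  is_derive x v g dg -> is_derive (g x) 1 f df ->
  is_derive x v (f \o g) (df * dg).
Proof.
move=> /is_derive_line Hg Hf; apply/is_derive_line.
apply: (@is_derive1_comp_ring _ f (fun h => g (h *: v + x))) => //.
by rewrite scale0r add0r.
Qed.

Lemma is_derive_continuous (K : numFieldType) (f : K -> K) (x d : K) :
  is_derive x 1 f d -> {for x, continuous f}.
Proof. by move=> [fd _]; apply/differentiable_continuous/derivable1_diffP. Qed.

Section DeriveRules.
Variables (K : numFieldType) (V : normedModType K) (x v : V).
Implicit Types (f g : V -> K) (a b c : K).

Lemma dC_cst c : is_derive x v (fun=> c) (0 : K).
Proof. exact: is_derive_cst. Qed.

Lemma dC_add f g a b : is_derive x v f a -> is_derive x v g b ->
  is_derive x v (fun y => f y + g y) (a + b).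
Proof. exact: is_deriveD. Qed.

Lemma dC_sub f g a b : is_derive x v f a -> is_derive x v g b ->
  is_derive x v (fun y => f y - g y) (a - b).
Proof. exact: is_deriveB. Qed.

Lemma dC_scale f c a : is_derive x v f a ->
  is_derive x v (fun y => c * f y) (c * a).
Proof. exact: is_deriveZ. Qed.

Lemma dC_mul f g a b : is_derive x v f a -> is_derive x v g b ->
  is_derive x v (fun y => f y * g y) (a * g x + f x * b).
Proof.
move=> Df Dg; rewrite addrC [a * _]mulrC; exact: is_deriveM.
Qed.

Lemma is_derive_eqd f a b : is_derive x v f a -> a = b -> is_derive x v f b.
Proof. by move=> H <-. Qed.

End DeriveRules.

Lemma dC_id (K : numFieldType) (x : K) : is_derive x 1 (fun y : K => y) 1.
Proof. exact: is_derive_id. Qed.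

(** * Exponential and principal logarithm *)

Section Elementary.
Variable R : realType.
Local Notation C := R[i].
Implicit Types (w z : C).

Lemma cexpD w z : cexp (w + z) = cexp w * cexp z.
Proof.
rewrite /cexp /cis; apply: complex_ext.
  by rewrite !cReM !cImM cReD cImD /= expRD cosD sinD; ring.
by rewrite !cImM !cReM cReD cImD /= expRD cosD sinD; ring.
Qed.

Lemma cexp0 : cexp (0 : C) = 1.
Proof. by rewrite /cexp /cis /= expR0 cos0 sin0 mul1r. Qed.

Lemma cexp_neq0 z : cexp z != 0.
Proof.
apply/eqP => z0; have := cexpD z (- z); rewrite subrr cexp0 z0 mul0r.
by move/eqP; rewrite oner_eq0.
Qed.

Lemma cexpN z : cexp (- z) = (cexp z)^-1.
Proof.
by apply: (mulfI (cexp_neq0 z)); rewrite -cexpD subrr cexp0 mulfV ?cexp_neq0.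
Qed.

Lemma cexp_sum (I : Type) (s : seq I) (F : I -> C) :
  cexp (\sum_(i <- s) F i) = \prod_(i <- s) cexp (F i).
Proof. by apply: (big_morph _ cexpD cexp0). Qed.

Lemma cexpMn z n : cexp (n%:R * z) = cexp z ^+ n.
Proof.
elim: n => [|n IH]; first by rewrite mul0r cexp0.
by rewrite -[n.+1]addn1 natrD mulrDl mul1r cexpD IH exprD.
Qed.

(** With h = a + b i, the real and imaginary parts of exp h - 1 - h are
    combinations of e^a - 1 - a, cos b - 1 and sin b - b, which are o(h) by
    the real derivatives at 0, and of a sin b. *)
Lemma is_derive_cexp0 : is_derive (0 : C) 1 (@cexp R) 1.
Proof.
apply: cder => e e0.
pose k := Num.min 1 (e / 8); have k0 : 0 < k by rewrite lt_min ltr01 divr_gt0.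
have k1 : k <= 1 by rewrite ge_min lexx.
have ke : k <= e / 8 by rewrite ge_min lexx orbT.
have /is_deriveP De : is_derive (0 : R) 1 (@expR R) 1.
  by rewrite -[X in is_derive _ _ _ X](@expR0 R); exact: is_derive_expR.
have /is_deriveP Dc : is_derive (0 : R) 1 (@cos R) 0 by apply: is_derive_eq; rewrite sin0 oppr0.
have /is_deriveP Ds : is_derive (0 : R) 1 (@sin R) 1 by apply: is_derive_eq; rewrite cos0.
have [r1 r10 P1] := De k k0.
have [r2 r20 P2] := Dc k k0.
have [r3 r30 P3] := Ds k k0.
exists (Num.min k (Num.min r1 (Num.min r2 r3))).
  by rewrite !(lt_min, ltr01, divr_gt0, r10, r20).
move=> h; rewrite [in X in X -> _]lt_min => /andP[hk].
rewrite !lt_min => /and3P[h1 h2 h3]; have ha := Re_le_cmod h; have hb := Im_le_cmod h.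
have {P1} := P1 _ (le_lt_trans ha h1).
have {P2} := P2 _ (le_lt_trans hb h2).
have {P3} := P3 _ (le_lt_trans hb h3).
rewrite !addr0 !mulr1 !mulr0 subr0 cos0 sin0 expR0 subr0 cexp0.
move=> Hs Hc He; apply: le_trans (cmod_le_ReIm _) _ => /=.
rewrite /cexp /cis !(cReD, cReN, cImD, cImN, cReM, cImM) /=.
have m0 := cmod_ge0 h; move: (cmod h) m0 hk ha hb {h1 h2 h3} => m m0 hk ha hb.
set a := complex.Re h in ha He *; set b := complex.Im h in hb Hs Hc *.
set E := expR a in He *; set c := cos b in Hc *; set s := sin b in Hs *.
have kb : k * `|b| <= k * m by rewrite ler_pM2l.
have ka : k * `|a| <= k * m by rewrite ler_pM2l.
have c1 : `|c| <= 1 by exact: cos_max.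
have -> : (E * c - 0 * s - 1 - a) = (E - 1 - a) * c + (1 + a) * (c - 1).
  ring.
have -> : (E * s + 0 * c - 0 - b) = (E - 1 - a) * s + a * s + (s - b).
  ring.
have t1 : `|(E - 1 - a) * c| <= k * m.
  rewrite normrM -[leRHS]mulr1 ler_pM //; exact: le_trans ka.
have s1 : `|s| <= 1 by exact: sin_max.
have t2 : `|(E - 1 - a) * s| <= k * m.
  rewrite normrM -[leRHS]mulr1 ler_pM //; exact: le_trans ka.
have sm : `|s| <= 2 * m.
  rewrite -[s](subrK b); apply: le_trans (ler_normD _ _) _.
  have -> : 2 * m = 1 * m + m by ring.
  rewrite lerD //; apply: le_trans Hs _; apply: le_trans kb _.
  by rewrite ler_wpM2r.
have t3 : `|a * s| <= 2 * (k * m).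
  rewrite normrM; have -> : 2 * (k * m) = k * (2 * m) by ring.
  by rewrite ler_pM // (le_trans ha) // ltW.
have t4 : `|(1 + a) * (c - 1)| <= 2 * (k * m).
  rewrite normrM ler_pM //; last exact: le_trans kb.
  apply: le_trans (ler_normD _ _) _; rewrite normr1.
  by have := le_trans ha (ltW (lt_le_trans hk k1)); lra.
have t5 : `|s - b| <= k * m by exact: le_trans kb.
have := ler_normD ((E - 1 - a) * c) ((1 + a) * (c - 1)).
have := ler_normD ((E - 1 - a) * s + a * s) (s - b).
have := ler_normD ((E - 1 - a) * s) (a * s).
have : k * m <= e / 8 * m by rewrite ler_wpM2r.
have : 0 <= e * m by rewrite mulr_ge0 // ltW.
lra.
Qed.

Lemma is_derive_cexp z : is_derive z 1 (@cexp R) (cexp z).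
Proof.
have [->|zn0] := eqVneq z 0; first by rewrite cexp0; exact: is_derive_cexp0.
apply: cder => e e0.
have ez : 0 < e / cmod (cexp z) by rewrite divr_gt0 // cmod_gt0 cexp_neq0.
have [r r0 H] := cderP is_derive_cexp0 ez.
exists r => // h /H; rewrite addr0 cexp0 mulr1 => {}H.
have -> : cexp (h + z) - cexp z - h * cexp z = (cexp h - 1 - h) * cexp z.
  by rewrite cexpD; ring.
by rewrite cmodM -ler_pdivlMr ?cmod_gt0 ?cexp_neq0 // mulrAC.
Qed.

(** The plane without the nonpositive real axis. *)
Definition slit : set C := [set w | 0 < complex.Re w \/ complex.Im w != 0].

Lemma slit_neq0 w : slit w -> w != 0.
Proof. by move=> H; apply: contraPneq H => -> -[|/eqP//] /=; rewrite ltxx. Qed.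

Lemma cmod_sqr w : cmod w ^+ 2 = complex.Re w ^+ 2 + complex.Im w ^+ 2.
Proof. by rewrite cmod_def sqr_sqrtr // addr_ge0 ?sqr_ge0. Qed.

Lemma Re_div_cmod w : -1 <= complex.Re w / cmod w <= 1.
Proof.
rewrite -ler_norml normrM normfV (ger0_norm (cmod_ge0 _)).
have [->|w0] := eqVneq w 0; first by rewrite cmod0 invr0 mulr0.
by rewrite ler_pdivrMr ?cmod_gt0 // mul1r Re_le_cmod.
Qed.

Lemma cis_carg w : w != 0 -> w = (cmod w)%:C * cis (carg w).
Proof.
move=> w0; have m0 : 0 < cmod w by rewrite cmod_gt0.
have x1 := Re_div_cmod w.
have Hcos : cos (carg w) = complex.Re w / cmod w.
  by rewrite /carg; case: ifP => _; rewrite ?cosN acosK.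
have Hsin : sin (carg w) = complex.Im w / cmod w.
  have E : sin (acos (complex.Re w / cmod w)) = `|complex.Im w| / cmod w.
    rewrite sin_acos //; have -> : 1 - (complex.Re w / cmod w) ^+ 2 = (complex.Im w / cmod w) ^+ 2.
      rewrite !expr_div_n cmod_sqr; field.
      by rewrite -cmod_sqr expf_neq0 // gt_eqF.
    by rewrite sqrtr_sqr normrM normfV (ger0_norm (cmod_ge0 _)).
  rewrite /carg; case: ifPn => [i0|]; first by rewrite E ger0_norm.
  by rewrite -ltNge => i0; rewrite sinN E ltr0_norm // mulNr opprK.
apply: complex_ext; rewrite ?cReM ?cImM /= Hcos Hsin; field; rewrite gt_eqF //.
Qed.

Lemma clogK w : w != 0 -> cexp (clog w) = w.
Proof.
move=> w0; rewrite [RHS]cis_carg // /cexp /clog /= lnK //.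
by rewrite posrE cmod_gt0.
Qed.

Lemma clog1 : clog (1 : C) = 0.
Proof. by rewrite /clog /carg cmod1 ln1 /= lexx divr1 acos1. Qed.

(** The two cases in the definition of the argument meet along the positive
    real axis; this formula shows that it is continuous there. *)
Lemma carg_Re_gt0 w : 0 < complex.Re w ->
  carg w = atan (complex.Im w / complex.Re w).
Proof.
move=> r0; set y := complex.Im w / complex.Re w.
have cosy : cos (atan y) = complex.Re w / cmod w.
  rewrite cos_atan; have -> : 1 + y ^+ 2 = (cmod w / complex.Re w) ^+ 2.
    by rewrite [in RHS]expr_div_n cmod_sqr /y; field; rewrite gt_eqF.
  by rewrite sqrtr_sqr ger0_norm ?invf_div // divr_ge0 ?cmod_ge0 // ltW.
have := atan_ltpi2 y; have := atan_gtNpi2 y; have := pi_gt0 R => pi0 y1 y2.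
rewrite /carg -cosy; case: ifPn => [i0|].
  rewrite cosK // in_itv /=; apply/andP; split; last by lra.
  by rewrite -atan0 le_atan // divr_ge0 // ltW.
rewrite -ltNge => i0; rewrite -[cos _]cosN cosK ?opprK // in_itv /=.
apply/andP; split; last by lra.
by rewrite oppr_ge0 -[leRHS]atan0 le_atan // mulr_le0_ge0 ?invr_ge0 // ltW.
Qed.

Lemma slit_nbhs w : slit w -> \forall z \near w, slit z.
Proof.
case=> w0.
  have : \forall z \near w, 0 < complex.Re z.
    exact: (@cvgr_gt _ _ _ (nbhs_filter w) _ _ (@Re_continuous R w) 0 w0).
  by apply: filterS => z; left.
have : \forall z \near w, complex.Im z != 0.
  exact: (@cvgr_neq0 _ _ _ _ (nbhs_filter w) _ _ (@Im_continuous R w) w0).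
by apply: filterS => z; right.
Qed.

Lemma carg_continuous w : slit w -> {for w, continuous (@carg R)}.
Proof.
have quot : w != 0 -> {for w, continuous (fun z : C => complex.Re z / cmod z)}.
  move=> w0; apply: (@cvgM _ _ _ (nbhs_filter w)); first exact: Re_continuous.
  by apply: (@cvgV _ _ _ (nbhs_filter w)); [rewrite cmod_eq0|exact: cmod_continuous].
have qlt : complex.Im w != 0 -> -1 < complex.Re w / cmod w < 1.
  move=> i0; rewrite -ltr_norml normrM normfV (ger0_norm (cmod_ge0 _)).
  rewrite ltr_pdivrMr ?cmod_gt0 ?slit_neq0 //; last by right.
  rewrite mul1r -(@ltr_pXn2r _ 2) ?nnegrE ?cmod_ge0 // real_normK ?num_real //.
  by rewrite cmod_sqr ltrDl exprn_even_gt0.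
case=> w0.
  have H : {near nbhs w, (fun z => atan (complex.Im z / complex.Re z)) =1 @carg R}.
    have : \forall z \near w, 0 < complex.Re z.
      exact: (@cvgr_gt _ _ _ (nbhs_filter w) _ _ (@Re_continuous R w) 0 w0).
    by apply: filterS => z z0; rewrite carg_Re_gt0.
  rewrite /prop_for /continuous_at -(nbhs_singleton H).
  apply: cvg_trans (near_eq_cvg H) _.
  apply: (@continuous_comp _ _ _ (fun z : C => complex.Im z / complex.Re z) (@atan R)).
    apply: (@cvgM _ _ _ (nbhs_filter w)); first exact: Im_continuous.
    by apply: (@cvgV _ _ _ (nbhs_filter w)); [rewrite gt_eqF|exact: Re_continuous].
  exact: continuous_atan.
have wn0 : w != 0 by apply: slit_neq0; right.
have acosc : {for w, continuous (fun z : C => acos (complex.Re z / cmod z))}.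
  apply: (@continuous_comp _ _ _ (fun z : C => complex.Re z / cmod z) (@acos R)).
    exact: quot.
  exact/continuous_acos/qlt.
case: (ltgtP 0 (complex.Im w)) => [i0|i0|i0]; last by rewrite -i0 eqxx in w0.
  have H : {near nbhs w, (fun z => acos (complex.Re z / cmod z)) =1 @carg R}.
    have : \forall z \near w, 0 < complex.Im z.
      exact: (@cvgr_gt _ _ _ (nbhs_filter w) _ _ (@Im_continuous R w) 0 i0).
    by apply: filterS => z z0; rewrite /carg ltW.
  rewrite /prop_for /continuous_at -(nbhs_singleton H).
  exact: cvg_trans (near_eq_cvg H) _.
have H : {near nbhs w, (fun z => - acos (complex.Re z / cmod z)) =1 @carg R}.
  have : \forall z \near w, complex.Im z < 0.
    exact: (@cvgr_lt _ _ _ (nbhs_filter w) _ _ (@Im_continuous R w) 0 i0).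
  by apply: filterS => z z0; rewrite /carg leNgt z0.
rewrite /prop_for /continuous_at -(nbhs_singleton H).
apply: cvg_trans (near_eq_cvg H) _.
exact: (@cvgN _ _ _ _ (nbhs_filter w)).
Qed.

Lemma clog_continuous w : slit w -> {for w, continuous (@clog R)}.
Proof.
move=> sw; apply: (@cvg_ReIm _ _ _ (nbhs_filter w)) => /=; last exact: carg_continuous.
apply: (@continuous_comp _ _ _ (@cmod R : C -> R) (@ln R)).
  exact: cmod_continuous.
by apply: continuous_ln; rewrite cmod_gt0 slit_neq0.
Qed.

(** The logarithm is a continuous right inverse of the exponential, whose
    derivative does not vanish; hence it is differentiable, with the inverse
    derivative. *)
Lemma is_derive_clog w : slit w -> is_derive w 1 (@clog R) w^-1.
Proof.
move=> sw; have w0 := slit_neq0 sw.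
have m0 : 0 < cmod w by rewrite cmod_gt0.
apply: cder => e e0.
pose k := Num.min (cmod w / 2) (e * cmod w ^+ 2 / 2).
have k0 : 0 < k by rewrite lt_min !(mulr_gt0, divr_gt0) ?exprn_gt0.
have [r1 r10 H] := cderP (is_derive_cexp (clog w)) k0.
have /nbhsC[r2 r20 H2] : \forall z \near w, z != 0 /\ cmod (clog z - clog w) < r1.
  apply: filterI; first by apply: filterS (slit_nbhs sw) => z /slit_neq0.
  by have /(@cvgCP _ _ _ (nbhs_filter w)) := clog_continuous sw; exact.
exists r2 => // h hr.
have /H2[h0] : cmod (h + w - w) < r2 by rewrite addrK.
set d := clog (h + w) - clog w => /H.
have -> : cexp (d + clog w) = h + w by rewrite /d subrK clogK.
rewrite clogK // addrK => Hd.
have Hd1 : cmod (h - d * w) <= cmod w / 2 * cmod d.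
  by apply: le_trans Hd _; rewrite ler_wpM2r ?cmod_ge0 // ge_min lexx.
have dh : cmod d <= 2 * cmod h / cmod w.
  rewrite ler_pdivlMr // -cmodM.
  have := cmodD h (- (h - d * w)); rewrite cmodN opprB addrC subrK => X.
  have : cmod (d * w) = cmod d * cmod w by rewrite cmodM.
  lra.
have -> : d - h * w^-1 = - (h - d * w) / w by field.
rewrite cmodM cmodN cmodV ler_pdivrMr //.
apply: le_trans Hd _.
have : k * cmod d <= e * cmod w ^+ 2 / 2 * cmod d.
  by rewrite ler_wpM2r ?cmod_ge0 // ge_min lexx orbT.
move/le_trans; apply.
apply: le_trans (ler_wpM2l _ dh) _; first by rewrite divr_ge0 // mulr_ge0 ?ltW // exprn_gt0.
rewrite le_eqVlt; apply/orP; left; apply/eqP; field; by rewrite gt_eqF.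
Qed.

Lemma is_derive_Re_segment (f : C -> C) (a v d : C) (s : R) :
  is_derive (a + s%:C * v) 1 f d ->
  is_derive s 1 (fun s : R => complex.Re (f (a + s%:C * v))) (complex.Re (v * d)).
Proof.
move=> D; apply/is_deriveP => e e0.
have v0 : 0 < cmod v + 1 by rewrite ltr_wpDl // cmod_ge0.
have [r r0 H] := cderP D (divr_gt0 e0 v0).
exists (r / (cmod v + 1)); first exact: divr_gt0.
move=> h hr; have hv : cmod (h%:C * v) <= `|h| * (cmod v + 1).
  by rewrite cmodM cmod_real ler_wpM2l // lerDl.
have /H : cmod (h%:C * v) < r.
  by apply: le_lt_trans hv _; rewrite -ltr_pdivlMr.
have -> : h%:C * v + (a + s%:C * v) = a + (h + s)%:C * v by rewrite rmorphD; ring.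
set A := f _ => HA.
have -> : complex.Re A - complex.Re (f (a + s%:C * v)) - h * complex.Re (v * d) =
  complex.Re (A - f (a + s%:C * v) - h%:C * v * d).
  by rewrite !cReD !cReN -[h%:C * v * d]mulrA (cReM h%:C) /= mul0r subr0.
apply: le_trans (Re_le_cmod _) _; apply: le_trans HA _.
apply: le_trans (ler_wpM2l _ hv) _; first by rewrite divr_ge0 // ltW.
by rewrite [X in _ * X]mulrC mulrA divfK // gt_eqF.
Qed.

(** Mean value inequality. The real mean value theorem bounds the real part of
    u (f b - f a) for every u of modulus 1; u = 1 and u = i together cost the
    factor 2. *)
Lemma cmvi (f f' : C -> C) (a b : C) (M : R) :
  (forall s : R, 0 <= s <= 1 ->
     is_derive (a + s%:C * (b - a)) 1 f (f' (a + s%:C * (b - a)))) ->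
  (forall s : R, 0 <= s <= 1 -> cmod (f' (a + s%:C * (b - a))) <= M) ->
  cmod (f b - f a) <= 2 * M * cmod (b - a).
Proof.
move=> D B; set v := b - a in D B *.
have key (u : C) : cmod u = 1 -> `|complex.Re (u * (f b - f a))| <= M * cmod v.
  move=> u1.
  have D' (s : R) : 0 <= s <= 1 ->
      is_derive s 1 (fun s : R => complex.Re (u * f (a + s%:C * v)))
        (complex.Re (v * (u * f' (a + s%:C * v)))).
    move=> s01; apply: (@is_derive_Re_segment (fun z => u * f z)).
    have := D s s01 => Ds.
    exact: (@is_deriveZ _ _ _ f u).
  have [||c c01] := @MVT_segment R (fun s => complex.Re (u * f (a + s%:C * v)))
    (fun s => complex.Re (v * (u * f' (a + s%:C * v)))) 0 1 ler01.
  - by move=> s; rewrite in_itv /= => /andP[s0 s1]; apply: D'; rewrite !ltW.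
  - apply: continuous_in_subspaceT => s; rewrite inE /= in_itv /= => s01.
    exact: is_derive_continuous (D' s s01).
  rewrite subr0 mulr1 mul1r mul0r addr0 subrKC -cReN -cReD -mulrBr => ->.
  apply: le_trans (Re_le_cmod _) _; rewrite !cmodM u1 mul1r mulrC.
  by rewrite ler_wpM2r ?cmod_ge0 // B // -[X in is_true X]/(c \in `[0, 1]).
have k1 := key 1 (cmod1 R).
have ki : cmod ('i%C : C) = 1.
  by rewrite cmod_def /= expr0n expr1n add0r sqrtr1.
have := key _ ki; rewrite mul1r in k1; rewrite cReM /= mul0r sub0r mul1r normrN => k2.
apply: le_trans (cmod_le_ReIm _) _.
by rewrite -mulrA mulr_natl mulr2n lerD.
Qed.

End Elementary.

(** * Series of holomorphic functions *)

Local Opaque cexp clog cmod.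

Section Series.
Variable R : realType.
Local Notation C := R[i].
Implicit Types (w z : C).

Lemma sum_invsqr_le m : \sum_(1 <= k < m.+1) (k%:R ^+ 2 : R)^-1 <= 2.
Proof.
suff H : \sum_(1 <= k < m.+2) (k%:R ^+ 2 : R)^-1 <= 2 - (m.+1%:R)^-1.
  case: m H => [|m] H; first by rewrite big_geq.
  rewrite big_nat_recr //= in H.
  apply: (@le_trans _ _ (2 - m.+2%:R^-1)); last by rewrite gerBl.
  by apply: le_trans H; rewrite lerDl invr_ge0 sqr_ge0.
elim: m => [|m IH]; first by rewrite big_nat1 expr1n invr1; lra.
rewrite big_nat_recr //=.
apply: le_trans (lerD IH (lexx _)) _.
have x0 : (0 : R) < m.+1%:R by [].
rewrite -[m.+2%:R]natr1; move: (m.+1%:R : R) x0 => x x0.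
have -> : 2 - x^-1 + (x + 1) ^- 2 = 2 - (x + 1)^-1 - (x * (x + 1) ^+ 2)^-1.
  field; apply/andP; split; rewrite gt_eqF //; lra.
rewrite gerBl invr_ge0 mulr_ge0 ?sqr_ge0 //; lra.
Qed.

(** Adding A / k^2 to each term splits the series into a difference of series
    with nonnegative terms and bounded partial sums. *)
Lemma rsum_cvg (u : nat -> R) (A : R) :
  (forall k, (0 < k)%N -> `|u k| <= A / k%:R ^+ 2) ->
  cvgn (fun m => \sum_(1 <= k < m.+1) u k).
Proof.
move=> H; have A0 : 0 <= A.
  by have := H 1%N isT; rewrite expr1n divr1; exact: le_trans.
have pos (v : nat -> R) (B : R) : (forall k, (0 < k)%N -> 0 <= v k <= B / k%:R ^+ 2) ->
    cvgn (fun m => \sum_(1 <= k < m.+1) v k).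
  move=> Hv; have B0 : 0 <= B.
    by have /andP[] := Hv 1%N isT; rewrite expr1n divr1; exact: le_trans.
  apply: nondecreasing_is_cvgn.
    apply/nondecreasing_seqP => m; rewrite [leRHS]big_nat_recr //= lerDl.
    by have /andP[] := Hv m.+1 isT.
  exists (B * 2) => _ [m _ <-].
  apply: (@le_trans _ _ (\sum_(1 <= k < m.+1) B / k%:R ^+ 2)).
    rewrite !big_nat; apply: ler_sum => k /andP[k0 _].
    by have /andP[] := Hv k k0.
  by rewrite -mulr_sumr ler_wpM2l // sum_invsqr_le.
have -> : (fun m => \sum_(1 <= k < m.+1) u k) =
    (fun m => \sum_(1 <= k < m.+1) (u k + A / k%:R ^+ 2)) \-
    (fun m => \sum_(1 <= k < m.+1) A / k%:R ^+ 2).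
  by apply/funext => m /=; rewrite big_split /= addrK.
apply: is_cvgB.
  apply: (pos _ (2 * A)) => k k0; have := H k k0; rewrite ler_norml => /andP[h1 h2].
  apply/andP; split; first by lra.
  by rewrite -mulrA; move: (A / _) h1 h2 => b; lra.
by apply: (pos _ A) => k k0; rewrite lexx andbT divr_ge0 // sqr_ge0.
Qed.

Definition csum (u : nat -> C) (m : nat) : C := \sum_(1 <= k < m.+1) u k.

Lemma csum_cvg (u : nat -> C) (A : R) :
  (forall k, (0 < k)%N -> cmod (u k) <= A / k%:R ^+ 2) ->
  csum u m @[m --> \oo] --> lim (csum u m @[m --> \oo]).
Proof.
move=> H.
have /cvg_ex[/= a Ha] : cvgn (fun m => \sum_(1 <= k < m.+1) complex.Re (u k)).
  by apply: (@rsum_cvg _ A) => k k0; apply: le_trans (Re_le_cmod _) (H k k0).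
have /cvg_ex[/= b Hb] : cvgn (fun m => \sum_(1 <= k < m.+1) complex.Im (u k)).
  by apply: (@rsum_cvg _ A) => k k0; apply: le_trans (Im_le_cmod _) (H k k0).
apply/cvg_ex; exists (a +i* b); apply: cvg_ReIm => /=.
  have -> // : (fun m => complex.Re (csum u m)) =
    (fun m => \sum_(1 <= k < m.+1) complex.Re (u k)).
  by apply/funext => m; apply: (big_morph _ (@cReD R)).
have -> // : (fun m => complex.Im (csum u m)) =
  (fun m => \sum_(1 <= k < m.+1) complex.Im (u k)).
by apply/funext => m; apply: (big_morph _ (@cImD R)).
Qed.

Lemma cmod_sum (I : Type) (s : seq I) (P : pred I) (F : I -> C) :
  cmod (\sum_(i <- s | P i) F i) <= \sum_(i <- s | P i) cmod (F i).
Proof.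
elim/big_ind2: _ => [|x1 x2 y1 y2 h1 h2|//]; first by rewrite cmod0.
exact: le_trans (cmodD _ _) (lerD h1 h2).
Qed.

Lemma csum_le (u : nat -> C) (A : R) m : 0 <= A ->
  (forall k, (0 < k)%N -> cmod (u k) <= A / k%:R ^+ 2) ->
  cmod (csum u m) <= 2 * A.
Proof.
move=> A0 H; apply: le_trans (cmod_sum _ _ _) _.
apply: (@le_trans _ _ (\sum_(1 <= k < m.+1) A / k%:R ^+ 2)).
  by rewrite !big_nat; apply: ler_sum => k /andP[k0 _]; exact: H.
by rewrite -mulr_sumr mulrC ler_wpM2r // sum_invsqr_le.
Qed.

(** Termwise differentiation. The mean value inequality for L k z - z * l k w
    bounds the error of the linear approximation of L k at w by 2 B |h|^2 /
    k^2. These bounds are summable, so that the sum has a linear approximation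
    at w with an error of order |h|^2. *)
Lemma sum_derive (L l : nat -> C -> C) (w : C) (d B : R) :
  slit w ->
  (forall z, slit z -> exists A : R, forall k, (0 < k)%N ->
     cmod (L k z) <= A / k%:R ^+ 2) ->
  (exists A : R, forall k, (0 < k)%N -> cmod (l k w) <= A / k%:R ^+ 2) ->
  (forall k z, (0 < k)%N -> slit z -> is_derive z 1 (L k) (l k z)) ->
  0 < d -> 0 <= B ->
  (forall z, cmod (z - w) < d -> slit z /\ forall k, (0 < k)%N ->
     cmod (l k z - l k w) <= B * cmod (z - w) / k%:R ^+ 2) ->
  is_derive w 1 (fun z => lim (csum (L ^~ z) m @[m --> \oo]))
    (lim (csum (l ^~ w) m @[m --> \oo])).
Proof.
move=> sw HL [A HA] D d0 B0 HB.
have cL z : slit z -> csum (L ^~ z) m @[m --> \oo] --> lim (csum (L ^~ z) m @[m --> \oo]).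
  by case/HL => A' HA'; apply: csum_cvg HA'.
have cl := csum_cvg HA.
set F := (fun z => lim _); set S := lim _ in cl *.
have key h : cmod h < d -> cmod (F (h + w) - F w - h * S) <= 4 * B * cmod h ^+ 2.
  move=> hd; have [sh _] : slit (h + w) /\ True.
    by have [|] := HB (h + w); rewrite ?addrK.
  pose e k := L k (h + w) - L k w - h * l k w.
  have ek k : (0 < k)%N -> cmod (e k) <= 2 * B * cmod h ^+ 2 / k%:R ^+ 2.
    move=> k0; have := @cmvi R (fun z => L k z - z * l k w)
      (fun z => l k z - l k w) w (h + w) (B * cmod h / k%:R ^+ 2).
    rewrite addrK => X.
    have {X} := X _ _; have -> : L k (h + w) - (h + w) * l k w - (L k w - w * l k w) = e k.
      by rewrite /e; ring.
    have -> : 2 * (B * cmod h / k%:R ^+ 2) * cmod h = 2 * B * cmod h ^+ 2 / k%:R ^+ 2 by ring.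
    have small (s : R) : 0 <= s <= 1 -> cmod (w + s%:C * h - w) <= cmod h.
      move=> /andP[s0 s1]; rewrite addrAC subrr add0r cmodM cmod_real ger0_norm //.
      by rewrite ler_piMl // cmod_ge0.
    apply=> s s01.
      have [|sz _] := HB (w + s%:C * h); first exact: le_lt_trans (small s s01) hd.
      have Ds := D k _ k0 sz.
      apply: (dC_sub Ds); apply: is_derive_eqd (dC_mul (dC_id _) (dC_cst _ _ _)) _.
      by rewrite mul1r mulr0 addr0.
    have [|_ /(_ k k0) Hz] := HB (w + s%:C * h); first exact: le_lt_trans (small s s01) hd.
    apply: le_trans Hz _; rewrite ler_wpM2r ?invr_ge0 ?sqr_ge0 // ler_wpM2l //.
    exact: small.
  have cE : csum e m @[m --> \oo] --> F (h + w) - F w - h * S.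
    have -> : csum e = (fun m => csum (L ^~ (h + w)) m - csum (L ^~ w) m - h * csum (l ^~ w) m).
      by apply/funext => m; rewrite /csum /e !sumrB mulr_sumr.
    apply: cvgB; first by apply: cvgB; exact: cL.
    exact: (cvgM (cvg_cst h) cl).
  have -> : 4 * B * cmod h ^+ 2 = 2 * (2 * B * cmod h ^+ 2) by ring.
  have cm : cmod (csum e m) @[m --> \oo] --> cmod (F (h + w) - F w - h * S).
    exact: (cvg_comp _ _ cE (@cmod_continuous R _)).
  rewrite -(cvg_lim (@Rhausdorff R) cm).
  apply: limr_le; first by apply/cvg_ex; eexists; exact: cm.
  near=> m; apply: csum_le => //; by rewrite !mulr_ge0 // cmod_ge0.
apply: cder => eps eps0.
exists (Num.min d (eps / (4 * B + 1))).
  by rewrite lt_min d0 divr_gt0 //; lra.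
move=> h; rewrite lt_min => /andP[hd he].
apply: le_trans (key h hd) _; rewrite expr2 mulrA ler_wpM2r ?cmod_ge0 //.
move: he; rewrite ltr_pdivlMr; last by lra.
by have := cmod_ge0 h; nra.
Unshelve. all: by end_near. Qed.

(** If Re w > 0 the real part of k + s w is at least k. Otherwise put y = Im
    w: from k <= |k + s w| + s |w| and s |y| <= |k + s w| follows k |y| <=
    (|y| + |w|) |k + s w|. *)
Lemma slit_lower w : slit w -> exists2 c : R, 0 < c <= 1 &
  forall k (s : R), 0 <= s <= 1 -> c * k%:R <= cmod (k%:R + s%:C * w).
Proof.
move=> [r0|i0].
  exists 1; first by rewrite ltr01 lexx.
  move=> k s /andP[s0 _]; rewrite mul1r.
  apply: le_trans (Re_le_cmod _); rewrite cReD cReM natC /= mul0r subr0.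
  by rewrite ger0_norm ?lerDl ?addr_ge0 // mulr_ge0 // ltW.
set y := complex.Im w in i0 *.
have y0 : 0 < `|y| by rewrite normr_gt0.
have m0 := cmod_ge0 w.
have ym : 0 < `|y| + cmod w by rewrite ltr_pwDl.
exists (`|y| / (`|y| + cmod w)).
  by rewrite divr_gt0 //= ler_pdivrMr // mul1r lerDl.
move=> k s /andP[s0 s1].
rewrite mulrAC ler_pdivrMr //.
have h1 : s * `|y| <= cmod (k%:R + s%:C * w).
  apply: le_trans (Im_le_cmod _).
  by rewrite cImD cImM natC /= add0r mul0r addr0 normrM ger0_norm.
have h2 : k%:R <= cmod (k%:R + s%:C * w) + s * cmod w.
  have <- : cmod (- (s%:C * w)) = s * cmod w by rewrite cmodN cmodM cmod_real ger0_norm.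
  by rewrite -[leLHS](@cmod_nat R) -{1}[k%:R](addrK (s%:C * w) k%:R) cmodD.
move: (cmod (k%:R + s%:C * w)) h1 h2 => q h1 h2.
have : `|y| * k%:R <= `|y| * (q + s * cmod w) by rewrite ler_wpM2l.
have : s * `|y| * cmod w <= q * cmod w by rewrite ler_wpM2r.
lra.
Qed.

Lemma slit_near w : slit w -> exists2 c : R, 0 < c <= 1 &
  forall z, cmod (z - w) < c -> slit z /\ forall k, (0 < k)%N ->
    c * k%:R <= cmod (k%:R + z).
Proof.
move=> sw; have [c /andP[c0 c1] H] := slit_lower sw.
have /nbhsC[d d0 Hd] := slit_nbhs sw.
exists (Num.min d (c / 2)).
  rewrite lt_min d0 divr_gt0 //= ge_min; apply/orP; right; lra.
move=> z; rewrite lt_min => /andP[zd zc]; split; first exact: Hd.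
move=> k k0.
have h1 : c * k%:R <= cmod (k%:R + w) by have := H k 1; rewrite mul1r; apply; rewrite ler01 lexx.
have h2 : cmod (k%:R + w) <= cmod (k%:R + z) + cmod (z - w).
  have -> : k%:R + w = (k%:R + z) + (w - z) by ring.
  by apply: le_trans (cmodD _ _) _; rewrite (cmodB w).
have k1 : (1 : R) <= k%:R by rewrite ler1n.
have : Num.min d (c / 2) * k%:R <= c / 2 * k%:R.
  by rewrite ler_wpM2r // ge_min lexx orbT.
nra.
Qed.

Lemma slit_1Ddiv (k : nat) (s : R) z : (0 < k)%N -> 0 <= s -> slit z ->
  slit (1 + s%:C * z / k%:R).
Proof.
move=> k0 s0 sz; have kR : (0 : R) < k%:R by rewrite ltr0n.
have -> : 1 + s%:C * z / k%:R = 1 + (s / k%:R)%:C * z.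
  by rewrite rmorphM fmorphV natC mulrAC.
have : 0 <= s / k%:R by rewrite divr_ge0.
move: (s / k%:R) => {s s0} s; rewrite le_eqVlt => /orP[/eqP<-|s0].
  by rewrite mul0r addr0; left.
case: sz => [r0|i0]; [left|right].
  by rewrite cReD cReM /= mul0r subr0 ltr_pwDl // mulr_ge0 // ltW.
by rewrite cImD cImM /= add0r mul0r addr0 mulf_neq0 // gt_eqF.
Qed.

End Series.

(** * The functions Lambda and Upsilon *)

Section GammaBarnes.
Variable R : realType.
Local Notation C := R[i].
Implicit Types (w z : C).

(** The logarithm of the k-th factor of the Weierstrass product of the gamma
    function. *)
Definition gamma_log (k : nat) z : C := z / k%:R - clog (1 + z / k%:R).
Definition gamma_dlog (k : nat) z : C := k%:R^-1 - (k%:R + z)^-1.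
(** The logarithm of the k-th factor of the product for G(z + 1). *)
Definition barnes_log (k : nat) z : C :=
  k%:R * clog (1 + z / k%:R) + z ^+ 2 / (2 * k%:R) - z.

Lemma natC_neq0 k : (0 < k)%N -> (k%:R : C) != 0.
Proof. by move=> k0; rewrite pnatr_eq0 -lt0n. Qed.

Lemma is_derive_clog1D k z : (0 < k)%N -> slit (1 + z / k%:R) ->
  is_derive z 1 (fun z => clog (1 + z / k%:R)) (k%:R + z)^-1.
Proof.
move=> k0 sz; have kn := natC_neq0 k0.
have H : is_derive z 1 (fun z : C => 1 + z / k%:R) k%:R^-1.
  apply: is_derive_eqd
    (dC_add (dC_cst _ _ 1) (dC_mul (dC_id z) (dC_cst _ _ k%:R^-1))) _.
  by rewrite add0r mul1r mulr0 addr0.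
have := is_derive_comp H (is_derive_clog sz).
rewrite (_ : (k%:R + z)^-1 = (1 + z / k%:R)^-1 / k%:R) //.
have zn := slit_neq0 sz.
have -> : k%:R + z = k%:R * (1 + z / k%:R) by field.
by rewrite invfM mulrC.
Qed.

Lemma gamma_dlogE k z : (0 < k)%N -> k%:R + z != 0 ->
  gamma_dlog k z = z / (k%:R * (k%:R + z)).
Proof. by move=> k0 zn; rewrite /gamma_dlog; field; rewrite zn natC_neq0. Qed.

Lemma is_derive_gamma_log k z : (0 < k)%N -> slit (1 + z / k%:R) ->
  is_derive z 1 (gamma_log k) (gamma_dlog k z).
Proof.
move=> k0 sz; have H := is_derive_clog1D k0 sz.
have H2 : is_derive z 1 (fun z : C => z / k%:R) k%:R^-1.
  apply: is_derive_eqd (dC_mul (dC_id z) (dC_cst _ _ k%:R^-1)) _.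
  by rewrite mul1r mulr0 addr0.
exact: dC_sub.
Qed.

Lemma slit1_neq0 k z : (0 < k)%N -> slit (1 + z / k%:R) -> k%:R + z != 0.
Proof.
move=> k0 sz; have kn := natC_neq0 k0; have zn := slit_neq0 sz.
have -> : k%:R + z = k%:R * (1 + z / k%:R) by field.
by rewrite mulf_neq0.
Qed.

(** The derivative is z times that of the k-th term for the gamma function:
    the relation between Lambda and Upsilon holds factor by factor. *)
Lemma is_derive_barnes_log k z : (0 < k)%N -> slit (1 + z / k%:R) ->
  is_derive z 1 (barnes_log k) (z * gamma_dlog k z).
Proof.
move=> k0 sz; have H := is_derive_clog1D k0 sz; have kn := natC_neq0 k0.
have zn := slit1_neq0 k0 sz.
have D2 := dC_mul (dC_mul (dC_id z) (dC_id z)) (dC_cst z 1 (2 * k%:R)^-1).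
apply: is_derive_eqd (dC_sub (dC_add (dC_scale k%:R H) D2) (dC_id z)) _.
by rewrite gamma_dlogE //; field; rewrite kn zn.
Qed.

Lemma gamma_dlog_le k z (c : R) : 0 < c -> (0 < k)%N -> c * k%:R <= cmod (k%:R + z) ->
  cmod (gamma_dlog k z) <= cmod z / c / k%:R ^+ 2.
Proof.
move=> c0 k0 H; have kR : (0 : R) < k%:R by rewrite ltr0n.
have q0 : 0 < c * k%:R by rewrite mulr_gt0.
have zn : k%:R + z != 0 by rewrite -cmod_gt0 (lt_le_trans q0).
rewrite gamma_dlogE // cmodM cmodV cmodM cmod_nat -mulrA -invfM.
rewrite ler_wpM2l ?cmod_ge0 // lef_pV2 ?posrE ?mulr_gt0 ?exprn_gt0 ?cmod_gt0 //.
by rewrite expr2 mulrCA ler_pM2l.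
Qed.

Lemma scale_le01 (s : R) z : 0 <= s <= 1 -> cmod (s%:C * z) <= cmod z.
Proof.
by move=> /andP[s0 s1]; rewrite cmodM cmod_real ger0_norm // ler_piMl ?cmod_ge0.
Qed.

(** The term vanishes at 0, so that the mean value inequality on the segment
    from 0 to z turns the bound on the derivative into one on the term. *)
Lemma gamma_log_le z : slit z -> exists A : R, forall k, (0 < k)%N ->
  cmod (gamma_log k z) <= A / k%:R ^+ 2.
Proof.
move=> sz; have [c /andP[c0 c1] H] := slit_lower sz.
exists (2 * (cmod z / c) * cmod z) => k k0.
have := @cmvi R (gamma_log k) (gamma_dlog k) 0 z (cmod z / c / k%:R ^+ 2).
have -> : gamma_log k 0 = 0 by rewrite /gamma_log mul0r addr0 clog1 subr0.
rewrite !subr0 => X.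
apply: le_trans (X _ _) _; last by rewrite le_eqVlt; apply/orP; left; apply/eqP; ring.
  move=> s /andP[s0 s1]; rewrite add0r; apply: is_derive_gamma_log => //.
  exact: slit_1Ddiv.
move=> s s01; rewrite add0r; apply: le_trans (gamma_dlog_le c0 k0 (H _ _ s01)) _.
rewrite ler_wpM2r ?invr_ge0 ?sqr_ge0 // ler_wpM2r ?invr_ge0 ?(ltW c0) //.
exact: scale_le01.
Qed.

Lemma barnes_log_le z : slit z -> exists A : R, forall k, (0 < k)%N ->
  cmod (barnes_log k z) <= A / k%:R ^+ 2.
Proof.
move=> sz; have [c /andP[c0 c1] H] := slit_lower sz.
exists (2 * (cmod z * (cmod z / c)) * cmod z) => k k0.
have := @cmvi R (barnes_log k) (fun z => z * gamma_dlog k z) 0 z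
  (cmod z * (cmod z / c) / k%:R ^+ 2).
have -> : barnes_log k 0 = 0.
  by rewrite /barnes_log mul0r addr0 clog1 mulr0 expr0n /= mul0r addr0 subr0.
rewrite !subr0 => X.
apply: le_trans (X _ _) _; last by rewrite le_eqVlt; apply/orP; left; apply/eqP; ring.
  move=> s /andP[s0 s1]; rewrite add0r; apply: is_derive_barnes_log => //.
  exact: slit_1Ddiv.
move=> s s01; rewrite add0r cmodM -mulrA ler_pM ?cmod_ge0 ?scale_le01 //.
apply: le_trans (gamma_dlog_le c0 k0 (H _ _ s01)) _.
rewrite ler_wpM2r ?invr_ge0 ?sqr_ge0 // ler_wpM2r ?invr_ge0 ?(ltW c0) //.
exact: scale_le01.
Qed.

Lemma slit_1D k z : (0 < k)%N -> slit z -> slit (1 + z / k%:R).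
Proof. by move=> k0 sz; rewrite -[z]mul1r; apply: slit_1Ddiv. Qed.

Lemma gamma_dlog_lip w z k (c : R) : (0 < k)%N -> 0 < c ->
  c * k%:R <= cmod (k%:R + w) -> c * k%:R <= cmod (k%:R + z) ->
  cmod (gamma_dlog k z - gamma_dlog k w) <= c ^- 2 * cmod (z - w) / k%:R ^+ 2.
Proof.
move=> k0 c0 Hw Hz; have kR : (0 : R) < k%:R by rewrite ltr0n.
have q0 : 0 < c * k%:R by rewrite mulr_gt0.
have zn : k%:R + z != 0 by rewrite -cmod_gt0 (lt_le_trans q0).
have wn : k%:R + w != 0 by rewrite -cmod_gt0 (lt_le_trans q0).
have -> : gamma_dlog k z - gamma_dlog k w = (z - w) / ((k%:R + z) * (k%:R + w)).
  by rewrite /gamma_dlog; field; rewrite zn wn natC_neq0.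
rewrite cmodM cmodV cmodM [_ ^- 2 * _]mulrC -mulrA -invfM -exprMn.
rewrite ler_wpM2l ?cmod_ge0 // lef_pV2 ?posrE ?mulr_gt0 ?exprn_gt0 ?cmod_gt0 //.
by rewrite expr2 ler_pM // ltW.
Qed.

Definition gamma_sum z : C := lim (csum (gamma_log ^~ z) m @[m --> \oo]).
Definition barnes_sum z : C := lim (csum (barnes_log ^~ z) m @[m --> \oo]).
Definition gamma_dsum z : C := lim (csum (gamma_dlog ^~ z) m @[m --> \oo]).

Lemma gamma_dlog_summable w : slit w -> exists A : R, forall k, (0 < k)%N ->
  cmod (gamma_dlog k w) <= A / k%:R ^+ 2.
Proof.
move=> sw; have [c /andP[c0 c1] H] := slit_near sw; exists (cmod w / c) => k k0.
by apply: gamma_dlog_le => //; have [|_] := H w; rewrite ?subrr ?cmod0 //; apply.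
Qed.

Lemma is_derive_gamma_sum w : slit w -> is_derive w 1 gamma_sum (gamma_dsum w).
Proof.
move=> sw; have [c /andP[c0 c1] H] := slit_near sw.
apply: (@sum_derive _ gamma_log gamma_dlog w c (c ^- 2) sw _ _ _ c0).
- exact: gamma_log_le.
- exact: gamma_dlog_summable.
- by move=> k z k0 sz; apply: is_derive_gamma_log => //; apply: slit_1D.
- by rewrite invr_ge0 sqr_ge0.
move=> z /H[sz Hz]; split=> // k k0; apply: gamma_dlog_lip => //; last exact: Hz.
by have [|_] := H w; rewrite ?subrr ?cmod0 //; apply.
Qed.

Lemma is_derive_barnes_sum w : slit w ->
  is_derive w 1 barnes_sum (w * gamma_dsum w).
Proof.
move=> sw; have [c /andP[c0 c1] H] := slit_near sw.
have -> : w * gamma_dsum w = lim (csum (fun k => w * gamma_dlog k w) m @[m --> \oo]).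
  have [A HA] := gamma_dlog_summable sw.
  apply/esym/cvg_lim; first exact: norm_hausdorff.
  have -> : csum (fun k => w * gamma_dlog k w) = (fun m => w * csum (gamma_dlog ^~ w) m).
    by apply/funext => m; rewrite /csum mulr_sumr.
  exact: (cvgM (cvg_cst w) (csum_cvg HA)).
pose B := (cmod w + 1) / c + cmod w * c ^- 2.
have w0 := cmod_ge0 w.
apply: (@sum_derive _ barnes_log (fun k z => z * gamma_dlog k z) w c B sw _ _ _ c0).
- exact: barnes_log_le.
- have [A HA] := gamma_dlog_summable sw; exists (cmod w * A) => k k0.
  by rewrite cmodM -mulrA ler_wpM2l // HA.
- by move=> k z k0 sz; apply: is_derive_barnes_log => //; apply: slit_1D.
- rewrite addr_ge0 // ?divr_ge0 ?mulr_ge0 ?invr_ge0 ?sqr_ge0 ?addr_ge0 //; exact: ltW.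
move=> z zc; have [sz Hz] := H z zc; split=> // k k0.
have Hw : c * k%:R <= cmod (k%:R + w).
  by have [|_] := H w; rewrite ?subrr ?cmod0 //; apply.
have -> : z * gamma_dlog k z - w * gamma_dlog k w =
  (z - w) * gamma_dlog k z + w * (gamma_dlog k z - gamma_dlog k w) by ring.
apply: le_trans (cmodD _ _) _; rewrite !cmodM /B mulrDl mulrDl lerD //.
  rewrite [X in X / _]mulrC -mulrA ler_wpM2l ?cmod_ge0 //.
  apply: le_trans (gamma_dlog_le c0 k0 (Hz k k0)) _.
  rewrite ler_wpM2r ?invr_ge0 ?sqr_ge0 // ler_wpM2r ?invr_ge0 ?(ltW c0) //.
  rewrite -[z](subrK w) addrC; apply: le_trans (cmodD _ _) _; rewrite lerD //.
  exact: le_trans (ltW zc) c1.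
rewrite -!mulrA ler_wpM2l //.
by have := gamma_dlog_lip k0 c0 Hw (Hz k k0); rewrite -mulrA.
Qed.

Lemma cexp_cvg (u : nat -> C) (a : C) : u m @[m --> \oo] --> a ->
  cexp (u m) @[m --> \oo] --> cexp a.
Proof.
move=> cu; apply: (cvg_comp _ _ cu).
exact: is_derive_continuous (is_derive_cexp a).
Qed.

Lemma Gamma_funE w : slit w ->
  Gamma_fun w = cexp (- (euler_gamma R)%:C * w) / w * cexp (gamma_sum w).
Proof.
move=> sw; rewrite /Gamma_fun; congr (_ * _).
apply/cvg_lim; first exact: norm_hausdorff.
have [A HA] := gamma_log_le sw.
have := cexp_cvg (csum_cvg HA); rewrite -/(gamma_sum w).
set u := (fun m => cexp _); set v := (fun m => _).
suff -> : u = v by [].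
apply/funext => m; rewrite /u /v /csum cexp_sum !big_nat.
apply: eq_bigr => k /andP[k0 _].
rewrite /gamma_log cexpD cexpN clogK; first by rewrite mulrC.
exact/slit_neq0/slit_1D.
Qed.

Lemma barnesGE w : slit w ->
  barnesG (w + 1) = cpow (2 * pi)%:C (w / 2) *
    cexp (- (w + w ^+ 2 * (1 + (euler_gamma R)%:C)) / 2) * cexp (barnes_sum w).
Proof.
move=> sw; rewrite /barnesG /= addrK; congr (_ * _).
apply/cvg_lim; first exact: norm_hausdorff.
have [A HA] := barnes_log_le sw.
have := cexp_cvg (csum_cvg HA); rewrite -/(barnes_sum w).
set u := (fun m => cexp _); set v := (fun m => _).
suff -> : u = v by [].
apply/funext => m; rewrite /u /v /csum cexp_sum !big_nat.
apply: eq_bigr => k /andP[k0 _].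
rewrite /barnes_log -addrA cexpD cexpMn clogK; first by [].
exact/slit_neq0/slit_1D.
Qed.

(** Up to an additive constant, a logarithm of Lambda on the slit plane. *)
Definition log_Lambda z : C :=
  z - (euler_gamma R)%:C * z - clog z + gamma_sum z - (z - 1 / 2) * clog z.
(** Up to an additive constant, a logarithm of Upsilon on the slit plane: the
    powers of 2 pi in Upsilon and in the Barnes function cancel. *)
Definition log_Upsilon z : C :=
  3 / 4 * z ^+ 2 - (z + z ^+ 2 * (1 + (euler_gamma R)%:C)) / 2 + barnes_sum z
  - z ^+ 2 / 2 * clog z.
Definition dlog_Lambda z : C :=
  gamma_dsum z - (euler_gamma R)%:C - clog z - (2 * z)^-1.

Lemma LambdaE : exists2 K : C, K != 0 &
  forall w, slit w -> Lambda w = K * cexp (log_Lambda w).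
Proof.
have s0 : ((Num.sqrt (2 * pi))%:C : C) != 0.
  rewrite -cmod_gt0 cmod_real normr_gt0 sqrtr_eq0 -ltNge mulr_gt0 // pi_gt0 //.
exists ((Num.sqrt (2 * pi))%:C)^-1; first by rewrite invr_eq0.
move=> w sw; rewrite /Lambda Gamma_funE // /cpow /log_Lambda !cexpD !cexpN.
rewrite mulNr cexpN clogK ?slit_neq0 //.
move: (Num.sqrt _)%:C s0 => S s0.
move: (cexp w) (cexp (_ * w)) (cexp (gamma_sum w)) (cexp (_ * clog w)).
by move=> a b c d; rewrite invfM; ring.
Qed.

Lemma UpsilonE : exists2 K : C, K != 0 &
  forall w, slit w -> Upsilon w = K * cexp (log_Upsilon w).
Proof.
exists (cexp (- derive1 (@riemann_zeta R) (-1))); first exact: cexp_neq0.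
move=> w sw; rewrite /Upsilon barnesGE //; move: (cexp (- derive1 _ _)) => K.
rewrite /cpow /log_Upsilon !cexpD mulNr !cexpN.
have := cexp_neq0 (w / 2 * clog (2 * pi)%:C).
have := cexp_neq0 ((w + w ^+ 2 * (1 + (euler_gamma R)%:C)) / 2).
have := cexp_neq0 (w ^+ 2 / 2 * clog w).
move: (cexp (_ * clog (2 * pi)%:C)) (cexp (_ * clog w)) (cexp (_ / 2)).
move: (cexp (barnes_sum w)) (cexp (_ * w ^+ 2)) => a b c d e d0 e0 c0.
by field; rewrite d0 e0 c0.
Qed.

Lemma is_derive_log_Lambda w : slit w ->
  is_derive w 1 log_Lambda (dlog_Lambda w).
Proof.
move=> sw; have w0 := slit_neq0 sw.
have D1 := is_derive_clog sw; have D2 := is_derive_gamma_sum sw.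
apply: is_derive_eqd (dC_sub (dC_add (dC_sub (dC_sub (dC_id w)
  (dC_scale (euler_gamma R)%:C (dC_id w))) D1) D2)
  (dC_mul (dC_sub (dC_id w) (dC_cst w 1 (1 / 2))) D1)) _.
by rewrite /dlog_Lambda; field.
Qed.

(** The identity (log Upsilon)' = w (log Lambda)', which is the reason for the
    shape of the tau-function. It holds for the infinite products, and the
    elementary factors of Upsilon extend it to the remaining ones. *)
Lemma is_derive_log_Upsilon w : slit w ->
  is_derive w 1 log_Upsilon (w * dlog_Lambda w).
Proof.
move=> sw; have w0 := slit_neq0 sw.
have D1 := is_derive_clog sw; have D2 := is_derive_barnes_sum sw.
have Dsq := dC_mul (dC_id w) (dC_id w).
apply: is_derive_eqd (dC_sub (dC_add (dC_sub (dC_scale (3 / 4) Dsq)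
  (dC_mul (dC_add (dC_id w) (dC_mul Dsq (dC_cst w 1 (1 + (euler_gamma R)%:C))))
    (dC_cst w 1 2^-1))) D2)
  (dC_mul (dC_mul Dsq (dC_cst w 1 2^-1)) D1)) _.
by rewrite /dlog_Lambda; field.
Qed.

Lemma near_slit_eq (f g : C -> C) w (d : C) : slit w ->
  (forall z, slit z -> f z = g z) -> is_derive w 1 g d -> is_derive w 1 f d.
Proof.
move=> sw fg; apply: near_eq_is_derive.
by apply: filterS (slit_nbhs sw) => z /fg ->.
Qed.

Lemma Lambda_neq0 w : slit w -> Lambda w != 0.
Proof. by move=> sw; have [K K0 ->] := LambdaE; rewrite // mulf_neq0 ?cexp_neq0. Qed.

Lemma Upsilon_neq0 w : slit w -> Upsilon w != 0.
Proof. by move=> sw; have [K K0 ->] := UpsilonE; rewrite // mulf_neq0 ?cexp_neq0. Qed.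

Lemma is_derive_Lambda w : slit w ->
  is_derive w 1 (@Lambda R) (dlog_Lambda w * Lambda w).
Proof.
move=> sw; have [K K0 E] := LambdaE; apply: (near_slit_eq sw E).
have H := is_derive_comp (is_derive_log_Lambda sw) (is_derive_cexp _).
by apply: is_derive_eqd (dC_scale K H) _; rewrite E //; ring.
Qed.

Lemma is_derive_Upsilon w : slit w ->
  is_derive w 1 (@Upsilon R) (w * dlog_Lambda w * Upsilon w).
Proof.
move=> sw; have [K K0 E] := UpsilonE; apply: (near_slit_eq sw E).
have H := is_derive_comp (is_derive_log_Upsilon sw) (is_derive_cexp _).
by apply: is_derive_eqd (dC_scale K H) _; rewrite E //; ring.
Qed.

End GammaBarnes.

(** * Divisors in the charge lattice *)

Section Lattice.
Variables (L : zmodType) (n : nat) (g : 'I_n -> L).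
Hypothesis gb : zbasis g.

Lemma lcoordP a : a = \sum_(i < n) g i *~ lcoord g a 0 i.
Proof.
have [m [am _]] := gb a.
by apply: (@xgetPex _ 0 [set m : 'rV[int]_n | a = \sum_(i < n) g i *~ m 0 i]); exists m.
Qed.

Lemma lcoord_unique a (m : 'rV[int]_n) : a = \sum_(i < n) g i *~ m 0 i ->
  lcoord g a = m.
Proof.
move=> am; have [m' [_ u]] := gb a.
by rewrite -(u _ am); apply/esym/u/lcoordP.
Qed.

Lemma lcoordMn a k : lcoord g (a *+ k) = lcoord g a *+ k.
Proof.
apply: lcoord_unique; rewrite {1}[a]lcoordP -sumrMnl; apply: eq_bigr => i _.
by rewrite mulmxnE pmulrn -mulrzA -[in RHS]mulr_natr natz.
Qed.

Lemma lcoord_inj : injective (lcoord g).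
Proof. by move=> a b ab; rewrite [a]lcoordP [b]lcoordP ab. Qed.

Lemma lcoord0 : lcoord g 0 = 0.
Proof. by apply: lcoord_unique; rewrite big1 // => i _; rewrite mxE mulr0z. Qed.

Lemma mulrn_injL (a b : L) k : (0 < k)%N -> a *+ k = b *+ k -> a = b.
Proof.
move=> k0 ab; apply: lcoord_inj; apply/matrixP => i j.
have := congr1 (fun m : 'rV[int]_n => m i j) (congr1 (lcoord g) ab).
rewrite !lcoordMn !mulmxnE => /eqP; by rewrite eqr_pMn2r // => /eqP.
Qed.

(** The l^1 norm of the coordinates. It is smaller at proper divisors, hence
    supports inductions on divisibility. *)
Definition lsize (a : L) : nat := (\sum_(i < n) `|lcoord g a ord0 i|)%N.

Lemma lsizeMn a k : lsize (a *+ k) = (k * lsize a)%N.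
Proof.
rewrite /lsize big_distrr /=; apply: eq_bigr => i _.
by rewrite lcoordMn mulmxnE -mulr_natr natz abszM absz_nat mulnC.
Qed.

Lemma lsize_gt0 a : a != 0 -> (0 < lsize a)%N.
Proof.
move=> a0; rewrite lt0n; apply: contra a0 => /eqP/eqP.
rewrite sum_nat_eq0 => /forallP H; apply/eqP/lcoord_inj; rewrite lcoord0.
by apply/matrixP => i j; rewrite (ord1 i) mxE; apply/eqP; rewrite -absz_eq0; exact: H.
Qed.

Definition divisors_of (a : L) : set (nat * L) :=
  [set x | (0 < x.1)%N /\ a = x.2 *+ x.1].

Lemma finite_divisors_of a : a != 0 -> finite_set (divisors_of a).
Proof.
move=> a0; pose f k := (k, xget 0 [set d : L | a = d *+ k]).
apply: (@sub_finite_set _ _ (f @` `I_(lsize a).+1)); last exact/finite_image/finite_II.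
move=> [k d] [/= k0 ad]; exists k => /=.
  rewrite ltnS ad lsizeMn leq_pmulr // lsize_gt0 //.
  by apply: contra_neq a0 => d0; rewrite ad d0 mul0rn.
congr (_, _); apply: xget_unique => // d'; rewrite /= ad => /esym.
exact: mulrn_injL.
Qed.

End Lattice.

(** Moebius inversion, as an induction on divisibility: in DT(a) the class a
    contributes Omega(a), and the other terms come from proper divisors of a,
    where the invariants agree by induction. *)
Lemma Omega_of_DT (R : realType) (L : zmodType) (n : nat) (g : 'I_n -> L)
    (B B' : bps R L) (a : L) : zbasis g -> a != 0 ->
  (forall d k, (0 < k)%N -> a = d *+ k -> DT B d = DT B' d) ->
  Omega B a = Omega B' a.
Proof.
move=> gb; have [m] := ubnP (lsize g a); elim: m a => // m IH a /ltnSE am a0 H.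
have := H a 1%N isT; rewrite mulr1n => /(_ erefl).
rewrite /DT -/(divisors_of a).
have fin := finite_divisors_of gb a0.
have a1 : divisors_of a (1%N, a) by rewrite /divisors_of /= mulr1n.
have E (B0 : bps R L) : \sum_(x \in divisors_of a) (Omega B0 x.2 / x.1%:R ^+ 2) =
    Omega B0 a + \sum_(x \in divisors_of a `\ (1%N, a)) (Omega B0 x.2 / x.1%:R ^+ 2).
  by rewrite (fsbigD1 (1%N, a) _ _ fin a1) /= expr1n divr1.
rewrite !E; set S := (X in _ + X = _); set S' := (X in _ = _ + X).
suff -> : S = S' by move/addIr.
apply: eq_fsbigr => -[k d]; rewrite inE => -[[/= k0 ad] kd1]; congr (_ / _).
have d0 : d != 0 by apply: contra_neq a0 => d0; rewrite ad d0 mul0rn.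
have k1 : (1 < k)%N.
  rewrite ltn_neqAle k0 andbT; apply/eqP => k1; apply: kd1.
  by rewrite ad -k1 mulr1n.
apply: IH => //.
  apply: leq_trans am; rewrite ad lsizeMn // -[X in (X < _)%N]mul1n.
  by rewrite ltn_pmul2r // lsize_gt0.
move=> d' k' k'0 dd'; apply: (H d' (k' * k)%N); first by rewrite muln_gt0 k'0.
by rewrite ad dd' mulrnA.
Qed.

(** * The Baker-Campbell-Hausdorff product of commuting elements *)

Section Bracket.
Variables (R : realType) (L : zmodType).
Local Notation C := R[i].
Variable br : (L -> C) -> (L -> C) -> (L -> C).

Lemma nested_bracket0 (P : set (L -> C)) : P 0 ->
  (forall x y, P x -> P y -> br x y = 0) ->
  forall w, all (fun x => `[< P x >]) w -> (1 < size w)%N ->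
  nested_bracket br w = 0.
Proof.
move=> P0 Pbr.
have H : forall w, all (fun x => `[< P x >]) w -> P (nested_bracket br w).
  elim=> [//|x [|y w] IH] /= /andP[/asboolP Px /IH Pw] //=.
  by rewrite Pbr.
move=> [|x [|y w]] // /= /andP[/asboolP Px Pw] _.
by apply: Pbr => //; exact: (H (y :: w)).
Qed.

(** In the Dynkin series every word of length at least 2 has a vanishing
    nested bracket, while the words of length 1 are X and Y, which occur once,
    for k = 0, with coefficient 1. *)
Lemma bch_add (P : set (L -> C)) (X Y : L -> C) : P 0 ->
  (forall x y, P x -> P y -> br x y = 0) -> P X -> P Y ->
  bch br X Y = X + Y.
Proof.
move=> P0 Pbr PX PY.
have allP r s : all (fun x => `[< P x >]) (nseq r X ++ nseq s Y).
  by rewrite all_cat !all_nseq; apply/andP; split; apply/orP; right; apply/asboolP.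
have nb0 := nested_bracket0 P0 Pbr.
suff key m : bch_partial br X Y m.+1 = X + Y.
  apply/funext => a; rewrite /bch; apply/cvg_lim; first exact: norm_hausdorff.
  rewrite -cvg_shiftS /=.
  have -> : (fun m => bch_partial br X Y m.+1 a) = fun=> (X + Y) a.
    by apply/funext => m; rewrite key.
  exact: cvg_cst.
rewrite /bch_partial big_ord_recl [X in _ + X]big1 ?addr0 => [|k _]; last first.
  apply: big1 => e /forallP He; rewrite nb0 ?scaler0 //.
    by elim: (enum _) => //= i l IH; rewrite all_cat allP IH.
  rewrite size_flatten /shape -map_comp sumnE big_map big_enum /=.
  apply: (@leq_trans (\sum_(i < k.+2) 1)); first by rewrite sum1_card card_ord.
  by apply: leq_sum => i _; rewrite size_cat !size_nseq.
pose h (p : 'I_m.+2 * 'I_m.+2) : {ffun 'I_1 -> 'I_m.+2 * 'I_m.+2} := [ffun=> p].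
rewrite (reindex h) /=; last first.
  exists (fun e => e ord0) => [p|e] _; first by rewrite ffunE.
  by apply/ffunP => i; rewrite ffunE (ord1 i).
(* The exponents (1, 0) and (0, 1) give the words X and Y. *)
pose one : 'I_m.+2 := lift ord0 ord0.
have term p : nested_bracket br (flatten [seq nseq (h p i).1 X ++ nseq (h p i).2 Y
      | i <- enum 'I_1]) = nested_bracket br (nseq p.1 X ++ nseq p.2 Y).
  by rewrite enum_ordSl enum_ord0 /= cats0 !ffunE.
rewrite (bigD1 (one, ord0)) /=; last first.
  by apply/forallP => i; rewrite ffunE.
rewrite (bigD1 (ord0, one)) /=; last first.
  by rewrite andbT; apply/forallP => i; rewrite ffunE.
rewrite !term /= [X in _ + (_ + X)]big1 ?addr0 => [|[r s] /andP[/andP[/forallP/(_ ord0) H1 H2] H3]].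
  rewrite !big_ord1 !ffunE /= expr0 !(addn0, add0n, muln1, mul1n, fact0, factS).
  by rewrite !invr1 !mulr1 !scale1r.
rewrite term nb0 ?scaler0 // size_cat !size_nseq /=.
move: H1 H2 H3; rewrite ffunE !xpair_eqE -!val_eqE /=.
by case: (nat_of_ord r) => [|[|?]]; case: (nat_of_ord s) => [|[|?]].
Qed.

Lemma foldr_bch (P : set (L -> C)) (s : seq (L -> C)) : P 0 ->
  (forall x y, P x -> P y -> P (x + y)) ->
  (forall x y, P x -> P y -> br x y = 0) ->
  all (fun x => `[< P x >]) s -> foldr (bch br) 0 s = \sum_(x <- s) x.
Proof.
move=> P0 PD Pbr.
suff H : all (fun x => `[< P x >]) s -> foldr (bch br) 0 s = \sum_(x <- s) x /\
   P (foldr (bch br) 0 s) by move=> /H[].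
elim: s => [|x s IH] /=; first by rewrite big_nil.
move=> /andP[/asboolP Px /IH[E Ps]]; rewrite (bch_add P0 Pbr Px Ps) big_cons E.
by split=> //; apply: PD => //; rewrite -E.
Qed.

End Bracket.

(** * Wall-crossing products of uncoupled structures *)

Section Uncoupled.
Variables (R : realType) (L : zmodType) (n : nat) (g : 'I_n -> L).
Variables (form : L -> L -> int) (N : 'rV[R]_n -> R) (B : bps R L).
Local Notation C := R[i].
Hypotheses (skew : skew_form form).
Hypotheses (finB : finite_bps B) (unB : uncoupled_bps form B).

(** The classes at which DT can be nonzero. *)
Definition active_multiple : set L :=
  [set c | exists2 a, active B a & exists k, c = a *+ k].

Lemma formDl a b c : form (a + b) c = form a c + form b c.
Proof. by case: skew. Qed.

Lemma formMnl a c k : form (a *+ k) c = form a c *+ k.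
Proof.
elim: k => [|k IH]; last by rewrite !mulrS formDl IH.
by have := formDl 0 0 c; rewrite addr0 => /eqP; rewrite -subr_eq0 opprD addNKr oppr_eq0 => /eqP.
Qed.

Lemma formC a b : form a b = - form b a.
Proof. by case: skew. Qed.

Lemma form_active_multiple a b :
  active_multiple a -> active_multiple b -> form a b = 0.
Proof.
move=> [a' Ba' [k ->]] [b' Bb' [m ->]].
by rewrite formMnl formC formMnl unB // mul0rn oppr0 mul0rn.
Qed.

Definition supported_on_multiples : set (L -> C) :=
  [set f | forall c, f c != 0 -> active_multiple c].

(** The bracket of x_a and x_b has the factor <a, b>, which vanishes for
    multiples of active classes. *)
Lemma lie_bracket_uncoupled S f h : supported_on_multiples f ->
  supported_on_multiples h -> lie_bracket form S f h = 0.
Proof.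
move=> Hf Hh; apply/funext => c; rewrite /lie_bracket /truncate /patch.
case: ifP => // _; apply: fsbig1 => a _.
have [->|fa] := eqVneq (f a) 0; first by rewrite mul0r mulr0.
have [->|hc] := eqVneq (h (c - a)) 0; first by rewrite mulr0 mulr0.
by rewrite (form_active_multiple (Hf _ fa) (Hh _ hc)) !mul0r.
Qed.

Lemma DT_neq0 c : DT B c != 0 -> exists a k,
  [/\ (0 < k)%N, active B a & c = a *+ k].
Proof.
apply: contra_neqP => H; apply: fsbig1 => -[k a] [/= k0 ca].
have [->|Ba] := eqVneq (Omega B a) 0; first by rewrite mul0r.
by case: H; exists a, k.
Qed.

Lemma DT_ray_supported r T : supported_on_multiples (DT_ray B r T).
Proof.
move=> c; rewrite /DT_ray /truncate /patch; case: ifP => _; last by rewrite eqxx.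
rewrite oppr_eq0 fmorph_eq0 => /DT_neq0[a [k [k0 Ba ->]]]; exists a => //.
by exists k.
Qed.

Lemma ray_scale (z w : C) (k : nat) : (0 < k)%N ->
  ray_of z (w *+ k) -> ray_of z w.
Proof.
move=> k0 [x [x0 E]]; have kR : (0 : R) < k%:R by rewrite ltr0n.
exists (x / k%:R); split; first exact: divr_gt0.
have kn : (k%:R : C) != 0 by rewrite pnatr_eq0 -lt0n.
apply: (mulfI kn); rewrite mulr_natl E rmorphM fmorphV rmorph_nat.
by rewrite mulrAC mulrCA mulfV // mulr1.
Qed.

Lemma cmodMn (w : C) k : (0 < k)%N -> cmod w <= cmod (w *+ k).
Proof.
move=> k0; rewrite -mulr_natl cmodM cmod_nat ler_peMl ?cmod_ge0 //.
by rewrite ler1n.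
Qed.

Section Product.
Variable I : interval R.
Hypothesis ray_inj : forall x y z, x \in I -> y \in I ->
  ray_of (cis x) z -> ray_of (cis y) z -> x = y.

Lemma ray_heightP r T :
  (ray_height B r < T%:E)%E <->
  exists a, [/\ active B a, r (Zch B a) & cmod (Zch B a) < T].
Proof.
split.
  move=> /ereal_inf_lt[_ [a [Ba ra] <-]]; rewrite lte_fin => aT.
  by exists a.
move=> [a [Ba ra aT]]; apply: le_lt_trans (_ : (cmod (Zch B a))%:E < _)%E.
  by apply: ereal_inf_lbound; exists a.
by rewrite lte_fin.
Qed.

Lemma finite_ray_angles T :
  finite_set [set x | x \in I /\ (ray_height B (ray_of (cis x)) < T%:E)%E].
Proof.
pose f a := xget 0 [set x | x \in I /\ ray_of (cis x) (Zch B a)].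
apply: (@sub_finite_set _ _ (f @` active B)); last exact: finite_image.
move=> x [/= xI /ray_heightP[a [Ba ra _]]]; exists a => //.
by apply: xget_unique => // y [yI ya]; apply: ray_inj ya ra.
Qed.

(** The factors of the product commute, so it is the exponential of the sum of
    the functions DT over the rays, and c lies on a single ray of the sector.
    If the height of that ray is at least T, then no divisor of c is active,
    so that DT(c) = 0. *)
Lemma clockwise_product_uncoupled K T c :
  sector I (Zch B c) -> cmod (Zch B c) < T ->
  clockwise_product g form N B I K T c = - ratr (DT B c).
Proof.
move=> [t tI tc] cT; rewrite /clockwise_product.
rewrite (@foldr_bch _ _ _ supported_on_multiples); last 4 first.
- by move=> x; rewrite eqxx.
- move=> x y Hx Hy z; rewrite -[(x + y) z]/(x z + y z).
  have [xz|xz _] := eqVneq (x z) 0; last exact: Hx.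
  by rewrite xz add0r; exact: Hy.
- by move=> x y Hx Hy; apply: lie_bracket_uncoupled.
- by rewrite all_map; apply/allP => x _ /=; apply/asboolP; exact: DT_ray_supported.
rewrite big_map fct_sumE.
have tval : DT_ray B (ray_of (cis t)) T c = - ratr (DT B c).
  by rewrite /DT_ray /truncate patchT // inE.
have xval x : x \in I -> x != t -> DT_ray B (ray_of (cis x)) T c = 0.
  move=> xI xt; rewrite /DT_ray /truncate patchC // inE /= => -[xc _].
  by move/eqP: xt; apply; apply: ray_inj xc tc.
have mem x : (x \in ray_angles B I T) =
    `[< x \in I /\ (ray_height B (ray_of (cis x)) < T%:E)%E >].
  by rewrite mem_sort in_fset_set ?inE //; exact: finite_ray_angles.
have [tin|tnin] := boolP (t \in ray_angles B I T).
  rewrite (bigD1_seq t) //=; last by rewrite sort_uniq fset_uniq.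
  rewrite tval big_seq_cond big1 ?addr0 // => x /andP[xin xt].
  by apply: xval => //; move: xin; rewrite mem => /asboolP[].
have -> : DT B c = 0.
  apply/eqP; apply: contraNT tnin => /DT_neq0[a [k [k0 Ba ca]]].
  rewrite mem; apply/asboolP; split=> //; apply/ray_heightP; exists a; split=> //.
    by apply: (ray_scale k0); rewrite -raddfMn -ca.
  by apply: le_lt_trans cT; rewrite ca raddfMn cmodMn.
rewrite rmorph0 oppr0 big_seq big1 // => x xin; apply: xval.
  by move: xin; rewrite mem => /asboolP[].
by apply: contraNneq tnin => <-.
Qed.

End Product.

End Uncoupled.

(** * Norms on the charge lattice *)

Section Norm.
Variables (R : realType) (n : nat) (N : 'rV[R]_n -> R).
Hypothesis Nn : is_norm N.

Lemma is_norm_sum (I : Type) (s : seq I) (F : I -> 'rV[R]_n) :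
  N (\sum_(i <- s) F i) <= \sum_(i <- s) N (F i).
Proof.
have [N0 _ NZ ND] := Nn.
elim: s => [|i s IH]; first by rewrite !big_nil -(scale0r 0) NZ normr0 mul0r.
by rewrite !big_cons; apply: le_trans (ND _ _) _; rewrite lerD2l.
Qed.

Lemma le_mx_norm (x : 'rV[R]_n) i : `|x 0 i| <= `|x|.
Proof. by rewrite [leRHS]mx_normrE; exact: (le_bigmax _ _ (0, i)). Qed.

Lemma is_norm_le : exists2 K : R, 0 <= K & forall x, N x <= K * `|x|.
Proof.
have [N0 _ NZ ND] := Nn.
exists (\sum_(i < n) N (delta_mx 0 i)); first by apply: sumr_ge0.
move=> x; rewrite {1}[x]row_sum_delta mulr_suml.
apply: le_trans (is_norm_sum _ _) _; apply: ler_sum => i _.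
by rewrite NZ mulrC ler_wpM2l // le_mx_norm.
Qed.

Lemma is_norm_continuous : continuous N.
Proof.
have [N0 _ NZ ND] := Nn; have [K K0 NK] := is_norm_le.
have dist x y : N x - N y <= K * `|x - y|.
  by rewrite lerBlDr -[in leLHS](subrK y x); apply: le_trans (ND _ _) _; rewrite lerD2r.
move=> x; apply/(@cvgrPdist_lt _ _ _ (nbhs x)) => e e0.
have K1 : 0 < K + 1 by lra.
near=> y; apply: (@le_lt_trans _ _ (K * `|x - y|)).
  by rewrite ler_norml lerNl opprB distrC dist distrC dist.
have xy : `|x - y| < e / (K + 1).
  near: y; have /cvgrPdist_lt/(_ (e / (K + 1))) := @cvg_id _ (nbhs x).
  by rewrite divr_gt0 // => /(_ isT).
apply: (@le_lt_trans _ _ ((K + 1) * `|x - y|)); first by rewrite ler_wpM2r // lerDl.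
by rewrite mulrC -ltr_pdivlMr.
Unshelve. all: by end_near. Qed.

(** The constant is the minimum of N on the unit sphere of the sup norm, which
    is compact. *)
Lemma is_norm_ge : exists2 c : R, 0 < c & forall x, c * `|x| <= N x.
Proof.
have [N0 Ndef NZ ND] := Nn.
pose S : set 'rV[R]_n := [set x | `|x| = 1].
have [[y0 Sy0]|nS] := pselect (exists y, S y); last first.
  exists 1 => // x; have [->|x0] := eqVneq x 0; first by rewrite normr0 mulr0.
  have nx : `|x| != 0 by rewrite normr_eq0.
  case: nS; exists (`|x|^-1 *: x).
  by rewrite /S /= normrZ normfV normr_id mulVf.
have cS : compact S.
  apply: bounded_closed_compact.
    by exists 1; split=> [|y y1 x]; [exact: real1|rewrite /S /= => ->; exact: ltW].
  rewrite (_ : S = (fun x => `|x|) @^-1` [set 1]) //.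
  apply: closed_comp => [x _|]; first exact: norm_continuous.
  by apply: accessible_closed_set1; apply: hausdorff_accessible; exact: Rhausdorff.
have [|x Sx Hx] := @EVT_min_rV R n N S (ex_intro _ y0 Sy0) cS.
  by apply: continuous_subspaceT; exact: is_norm_continuous.
rewrite inE /S /= in Sx.
have Nx : 0 < N x.
  rewrite lt0r N0 andbT; apply/eqP => /Ndef x0.
  by move/eqP: Sx; rewrite x0 normr0 eq_sym oner_eq0.
exists (N x) => // y; have [->|y0'] := eqVneq y 0; first by rewrite normr0 mulr0.
have ny : 0 < `|y| by rewrite normr_gt0.
have := Hx (`|y|^-1 *: y); rewrite inE /S /= normrZ normfV normr_id mulVf ?gt_eqF //.
by move=> /(_ erefl); rewrite NZ normfV normr_id mulrC ler_pdivlMr.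
Qed.

End Norm.

Section LatticeNorm.
Variables (R : realType) (L : zmodType) (n : nat) (g : 'I_n -> L).
Variable N : 'rV[R]_n -> R.
Hypotheses (gb : zbasis g) (Nn : is_norm N).

Lemma lnorm_ge0 a : 0 <= lnorm g N a.
Proof. by rewrite /lnorm; have [N0 _ _ _] := Nn; exact: N0. Qed.

Lemma lnorm_gt0 a : a != 0 -> 0 < lnorm g N a.
Proof.
move=> a0; rewrite lt0r lnorm_ge0 andbT; apply: contra_neq a0 => Na.
have [_ Ndef _ _] := Nn; have /Ndef x0 := Na.
apply: (lcoord_inj gb); rewrite lcoord0 //; apply/matrixP => i j.
have := congr1 (fun x : 'rV[R]_n => x i j) x0; rewrite !mxE => /eqP.
by rewrite intr_eq0 => /eqP.
Qed.

Lemma finite_lnorm_le (r : R) : finite_set [set a | lnorm g N a <= r].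
Proof.
have [c c0 Hc] := is_norm_ge Nn.
have [b Hb] : exists b : nat, r / c < b%:R.
  by exists (Num.truncn (r / c)).+1; exact: truncnS_gt.
pose f (x : {ffun 'I_n -> 'I_(b + b).+1}) := \sum_(i < n) g i *~ ((x i : nat)%:Z - b%:Z).
apply: (@sub_finite_set _ _ (f @` [set: {ffun 'I_n -> 'I_(b + b).+1}])).
  move=> a /= ar.
  have Hi i : `|(lcoord g a 0 i)%:~R : R| < b%:R.
    apply: le_lt_trans Hb; rewrite ler_pdivlMr // mulrC.
    apply: le_trans ar; apply: le_trans (Hc _); rewrite ler_wpM2l ?(ltW c0) //.
    have := le_mx_norm (map_mx (fun k : int => k%:~R) (lcoord g a) : 'rV[R]_n) i.
    by rewrite mxE.
  have Hi' i : (`|lcoord g a 0 i| < b%:Z)%R.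
    by have := Hi i; rewrite -intr_norm -[b%:R]/((b%:Z)%:~R) ltr_int.
  (* The coordinates lie between - b and b; they are shifted by b to become
     natural numbers. *)
  exists [ffun i => inord `|(lcoord g a 0 i + b%:Z)%R|%N] => //.
  rewrite /f [RHS](lcoordP gb); apply: eq_bigr => i _; congr (_ *~ _).
  have := Hi' i; rewrite ltr_norml => /andP[h1 h2].
  rewrite ffunE inordK.
    by rewrite gez0_abs ?addrK // -lerBlDr sub0r ltW.
  rewrite -ltz_nat gez0_abs -?lerBlDr ?sub0r ?ltW //.
  by apply: (@lt_trans _ _ (b%:Z + b%:Z)); rewrite ?ltrD2r // -PoszD ltz_nat.
exact/finite_image/finite_finset.
Qed.

Lemma support_bound_le (B : bps R L) (K K' : R) : K <= K' ->
  support_bound g N B K' -> support_bound g N B K.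
Proof.
by move=> KK H a /H; apply: le_lt_trans; rewrite ler_wpM2r // lnorm_ge0.
Qed.

End LatticeNorm.

(** * Acute sectors *)

Section Sector.
Variable R : realType.
Local Notation C := R[i].
Implicit Types (z : C) (x y t k : R).

Lemma cisD x y : cis (x + y) = cis x * cis y :> C.
Proof.
by apply: complex_ext; rewrite ?cReM ?cImM /= ?cosD ?sinD // addrC.
Qed.

Lemma cis0 : cis 0 = 1 :> C.
Proof. by rewrite /cis cos0 sin0. Qed.

Lemma cisN x : cis (- x) * cis x = 1 :> C.
Proof. by rewrite -cisD addNr cis0. Qed.

Lemma cmod_cis x : cmod (cis x) = 1 :> R.
Proof. by rewrite cmod_def /= cos2Dsin2 sqrtr1. Qed.

(** Unlike the definition by arguments, a bound on the slope is visibly an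
    open condition on z that can be compared with its boundary case. *)
Definition slope_sector t k : set C :=
  [set z | `|complex.Im (z * cis (- t))| < k * complex.Re (z * cis (- t))].

Definition sector_itv t k : interval R :=
  Interval (BSide false (t - atan k)) (BSide true (t + atan k)).

Lemma atan_lt_piquarter k : k < 1 -> atan k < pi / 4.
Proof. by move=> k1; rewrite -atan1; exact: lt_atan. Qed.

(** Both sides say that z * cis (- t) is nonzero with an argument of absolute
    value less than atan k. *)
Lemma sector_slope t k z : 0 < k -> k < 1 ->
  sector (sector_itv t k) z <-> slope_sector t k z.
Proof.
move=> k0 k1; rewrite /slope_sector /sector /=.
have a1 := atan_lt_piquarter k1; have pi0 := pi_gt0 R.
have a0 : 0 < atan k by rewrite -[ltLHS]atan0 lt_atan.
split.
  move=> [x]; rewrite in_itv /= => /andP[x1 x2] [s [s0 ->]].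
  have -> : s%:C * cis x * cis (- t) = s%:C * cis (x - t) by rewrite cisD mulrA.
  rewrite cReM cImM /= !mul0r subr0 addr0 normrM (gtr0_norm s0) mulrCA ltr_pM2l //.
  set d := x - t; have d1 : - atan k < d by rewrite /d; lra.
  have d2 : d < atan k by rewrite /d; lra.
  have dI : d \in `](- (pi / 2)), (pi / 2)[ by rewrite in_itv /=; apply/andP; split; lra.
  have c0 : 0 < cos d by apply: cos_gt0_pihalf; apply/andP; split; lra.
  have aI u : - (pi / 4) < u -> u < pi / 4 -> u \in `](- (pi / 2)), (pi / 2)[.
    by move=> u1 u2; rewrite in_itv /=; apply/andP; split; lra.
  rewrite -ltr_pdivrMr // -[X in _ / X](gtr0_norm c0) -normfV -normrM -/(tan d).
  rewrite ltr_norml; apply/andP; split.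
    by rewrite -[k]atanK -tanN ltr_tan // aI; lra.
  by rewrite -[k]atanK ltr_tan // aI; lra.
set v := z * cis (- t) => Hv.
have r0 : 0 < complex.Re v by rewrite -(pmulr_rgt0 _ k0); exact: le_lt_trans Hv.
have zv : z = v * cis t by rewrite /v -mulrA cisN mulr1.
have v0 : v != 0 by apply: contraTneq r0 => ->; rewrite ltxx.
exists (carg v + t); last first.
  exists (cmod v); split; first by rewrite cmod_gt0.
  by rewrite cisD mulrA -cis_carg.
rewrite (carg_Re_gt0 r0).
have : `|complex.Im v / complex.Re v| < k.
  by rewrite normrM normfV (gtr0_norm r0) ltr_pdivrMr.
rewrite ltr_norml => /andP[/lt_atan h1 /lt_atan h2]; rewrite atanN in h1.
by rewrite in_itv /=; apply/andP; split; lra.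
Qed.

Lemma sector_itv_acute t k : k < 1 -> t + atan k - (t - atan k) < pi / 2.
Proof. by move=> /atan_lt_piquarter; lra. Qed.

Lemma sector_ray_inj t k x y z : k < 1 ->
  x \in sector_itv t k -> y \in sector_itv t k ->
  ray_of (cis x) z -> ray_of (cis y) z -> x = y.
Proof.
move=> /atan_lt_piquarter a1; rewrite !in_itv /= => /andP[x1 x2] /andP[y1 y2].
move=> [s [s0 ->]] [s' [s'0 E]]; have pi0 := pi_gt0 R.
have : cmod (s%:C * cis x) = cmod (s'%:C * cis y) by rewrite E.
rewrite !cmodM !cmod_cis !cmod_real !mulr1 !gtr0_norm // => ss; subst s'.
have sn : (s%:C : C) != 0 by rewrite -cmod_gt0 cmod_real normr_gt0 gt_eqF.
have {}E := mulfI sn E.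
have : cis (x - y) = 1 :> C by rewrite cisD E mulrC cisN.
move=> /(congr1 (@complex.Im R)) /=; rewrite -sin0 => H.
have : x - y = 0 by apply: sin_inj H; rewrite in_itv /=; apply/andP; split; lra.
lra.
Qed.

Lemma slope_sectorMn t k z m : (0 < m)%N ->
  slope_sector t k (z *+ m) -> slope_sector t k z.
Proof.
move=> m0; rewrite /slope_sector /= -mulr_natl -mulrA natC cReM cImM /= !mul0r.
rewrite subr0 addr0 normrM gtr0_norm ?ltr0n // mulrCA ltr_pM2l ?ltr0n //.
Qed.

End Sector.

(** * Generic constants *)

Lemma avoid_finite (R : realType) (s : seq R) (a b : R) : a < b ->
  exists x, [/\ a < x, x < b & x \notin s].
Proof.
elim: s a b => [|y s IH] a b ab.
  by exists ((a + b) / 2); split; rewrite ?midf_lt.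
have [ay|ya] := ltP a y.
  have [|x [x1 x2 xs]] := IH a (Num.min y b); first by rewrite lt_min ay.
  move: x2; rewrite lt_min => /andP[xy xb]; exists x; split=> //.
  by rewrite inE negb_or xs lt_eqF.
have [x [x1 x2 xs]] := IH a b ab; exists x; split=> //.
by rewrite inE negb_or xs gt_eqF // (le_lt_trans ya).
Qed.

Lemma avoid_image (R : realType) (T : choiceType) (F : set T) (f : T -> R) (a b : R) :
  finite_set F -> a < b ->
  exists x, [/\ a < x, x < b & forall c, F c -> x != f c].
Proof.
move=> Ffin ab; have [x [x1 x2 xs]] := avoid_finite [seq f c | c <- fset_set F] ab.
exists x; split=> // c Fc; apply: contraNneq xs => ->.
by apply: map_f; rewrite in_fset_set // inE.
Qed.

Lemma near_finite (T : topologicalType) (p : T) (I : choiceType) (F : set I)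
    (P : I -> T -> Prop) : finite_set F ->
  (forall c, F c -> \forall q \near p, P c q) ->
  \forall q \near p, forall c, F c -> P c q.
Proof.
move=> Ffin H.
have : \forall q \near p, forall c, c \in enum_fset (fset_set F) -> P c q.
  have : forall c, c \in enum_fset (fset_set F) -> \forall q \near p, P c q.
    by move=> c; rewrite in_fset_set // inE => /H.
  elim: (enum_fset _) => [|c s IH] Hs; first by near=> q.
  apply: filterS2 (Hs c (mem_head _ _)) (IH _) => [q Pc Ps c'|c' cs].
    by rewrite inE => /orP[/eqP->|/Ps].
  by apply: Hs; rewrite inE cs orbT.
by apply: filterS => q Hq c Fc; apply: Hq; rewrite in_fset_set // inE.
Unshelve. all: by end_near. Qed.

Lemma near_lt_eq (R : realType) (T : topologicalType) (p : T) (f h : T -> R) :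
  {for p, continuous f} -> {for p, continuous h} -> f p != h p ->
  \forall q \near p, (f q < h q) = (f p < h p).
Proof.
move=> cf ch fh.
have cd : {for p, continuous (fun q => h q - f q)} by apply: cvgB.
case: (ltgtP (f p) (h p)) fh => // H _.
  have := @cvgr_gt _ _ _ _ _ _ cd 0; rewrite subr_gt0 => /(_ _ H).
  by apply: filterS => q; rewrite subr_gt0.
have := @cvgr_lt _ _ _ _ _ _ cd 0; rewrite subr_lt0 => /(_ _ H).
by apply: filterS => q; rewrite subr_lt0 => /ltW; rewrite leNgt => /negbTE.
Qed.

(** * Neighbourhoods in period coordinates *)

Section Polydisc.
Variables (R : realType) (n : nat).
Local Notation C := R[i].
Implicit Types (x y : 'rV[C]_n).

Definition polydisc x (r : R) : set 'rV[C]_n :=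
  [set y | forall i, cmod (y 0 i - x 0 i) < r].

Lemma nbhs_polydisc x (P : set 'rV[C]_n) : nbhs x P ->
  exists2 r : R, 0 < r & polydisc x r `<=` P.
Proof.
move=> /nbhs_ballP[e /= /gt0C[r r0 ->] H]; exists r => // y Hy; apply: H.
split; first by rewrite ltcR.
move=> i j; rewrite (ord1 i); rewrite -ball_normE /= cmodE ltcR cmodB.
exact: Hy.
Qed.

Lemma polydisc_nbhs x y (r : R) : polydisc x r y -> nbhs y (polydisc x r).
Proof.
move=> H; have near_i : forall i, \forall z \near y, cmod ((z : 'rV[C]_n) 0 i - x 0 i) < r.
  move=> i; have c : {for y, continuous (fun z : 'rV[C]_n => cmod (z 0 i - x 0 i))}.
    apply: (@continuous_comp _ _ _ (fun z : 'rV[C]_n => z 0 i - x 0 i)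
      (@cmod R : C -> R)); last exact: cmod_continuous.
    by apply: (@cvgB _ _ _ _ (nbhs_filter y)); [exact: coord_continuous|exact: cvg_cst].
  exact: (@cvgr_lt _ _ _ (nbhs_filter y) _ _ c r (H i)).
have : \forall z \near y, forall i, [set: 'I_n] i -> cmod ((z : 'rV[C]_n) 0 i - x 0 i) < r.
  by apply: near_finite => [|i _]; [exact: finite_finset|exact: near_i].
by apply: filterS => z Hz i; apply: Hz.
Qed.

Lemma polydisc_center x (r : R) : 0 < r -> polydisc x r x.
Proof. by move=> r0 i; rewrite subrr cmod0. Qed.

Lemma polydisc_segment x y (r s : R) : 0 <= s <= 1 -> polydisc x r y ->
  polydisc x r (x + s%:C *: (y - x)).
Proof.
move=> /andP[s0 s1] H i; rewrite !mxE addrAC subrr add0r.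
apply: le_lt_trans (H i); rewrite cmodM cmod_real ger0_norm //.
by rewrite ler_piMl // cmod_ge0.
Qed.

Definition polysquare x (r : R) : set 'rV[C]_n :=
  [set y | forall i, `|complex.Re (y 0 i - x 0 i)| <= r /\
                     `|complex.Im (y 0 i - x 0 i)| <= r].

Lemma polydisc_square x (r : R) : polydisc x r `<=` polysquare x r.
Proof.
move=> y H i; split; apply: ltW; apply: le_lt_trans (H i).
  exact: Re_le_cmod.
exact: Im_le_cmod.
Qed.

Lemma polysquare_disc x (r : R) : 0 < r -> polysquare x (r / 4) `<=` polydisc x r.
Proof.
move=> r0 y H i; have [h1 h2] := H i.
by apply: le_lt_trans (cmod_le_ReIm _) _; lra.
Qed.

Lemma square_compact (z : C) (r : R) :
  compact [set w : C | `|complex.Re (w - z)| <= r /\ `|complex.Im (w - z)| <= r].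
Proof.
pose f (u : R * R) : C := z + (u.1 +i* u.2).
rewrite (_ : mkset _ = f @` (`[- r, r] `*` `[- r, r])); last first.
  apply/seteqP; split=> [w /= [w1 w2]|_ [[a b] [/= + +] <-]].
    exists (complex.Re (w - z), complex.Im (w - z)) => /=.
      by rewrite !in_itv /= -!ler_norml.
    rewrite /f /=; apply: complex_ext.
      by rewrite cReD /= cReD cReN addrC subrK.
    by rewrite cImD /= cImD cImN addrC subrK.
  by rewrite !in_itv /= -!ler_norml /f addrAC subrr add0r.
apply: continuous_compact; last by apply: compact_setX; exact: segment_compact.
apply: continuous_subspaceT => u.
apply: (@cvgD _ _ _ _ (nbhs_filter u)); first exact: cvg_cst.
by apply: (@cvg_ReIm _ _ _ (nbhs_filter u)) => /=; [exact: cvg_fst|exact: cvg_snd].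
Qed.

Lemma polysquare_compact x (r : R) : compact (polysquare x r).
Proof.
pose S i := [set w : C | `|complex.Re (w - x 0 i)| <= r /\ `|complex.Im (w - x 0 i)| <= r].
exact: (@rV_compact _ n S (fun i => @square_compact (x 0 i) r)).
Qed.

End Polydisc.

Lemma onem_ge0_le1 (R : realType) (u : R) : 0 <= u <= 1 -> 0 <= 1 - u <= 1.
Proof. by move=> /andP[u0 u1]; rewrite subr_ge0 u1 gerBl. Qed.

Section Manifold.
Variables (R : realType) (M : complexManifold R).
Local Notation C := R[i].

Lemma mholo_continuous (W : normedModType C) (f : M -> W) (p : M) :
  mholo f p -> {for p, continuous f}.
Proof.
move=> hf; have [c [ac cp]] := atlas_cover p.
have [oc _ cK cc _] := atlas_chart ac.
have df : differentiable (f \o cinv c) (cfun c p) := nbhs_singleton (hf c ac cp).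
have : {for p, continuous ((f \o cinv c) \o cfun c)}.
  apply: continuous_comp; first exact: cc.
  exact: differentiable_continuous.
have E : {near nbhs p, ((f \o cinv c) \o cfun c) =1 f}.
  by apply: filterS (open_nbhs_nbhs (conj oc cp)) => q /cK /= ->.
rewrite /prop_for /continuous_at (nbhs_singleton E).
exact: cvg_trans (near_eq_cvg E).
Qed.

Variables (L : zmodType) (n : nat) (g : 'I_n -> L) (V : M -> bps R L).
Hypothesis mini : miniversal g V.
Local Notation per := (period g V).

(** A small polydisc in the period coordinates is star-shaped with respect to
    its centre. *)
Lemma small_contractible (p0 : M) (P : set M) : nbhs p0 P ->
  exists A : set M, [/\ open A, contractible A, A p0 & A `<=` P].
Proof.
move=> nP; have [s [A [B [oA oB Ap0 HA HB]]]] := mini p0.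
have [Bx0 sx0 _] := HA _ Ap0; have [_ _ [cs _]] := HB _ Bx0.
have [r r0 Hr] : exists2 r : R, 0 < r & polydisc (per p0) r `<=` (B `&` s @^-1` P).
  apply: nbhs_polydisc; apply: filterI; first exact: open_nbhs_nbhs.
  by apply: cs; rewrite sx0.
have pc q : A q -> {for q, continuous per}.
  by move=> /HA[_ _ /mholo_continuous].
exists (A `&` per @^-1` (polydisc (per p0) r)); split.
- rewrite openE => q [Aq Dq]; apply: filterI; first exact: open_nbhs_nbhs.
  by apply: (pc q Aq); exact: polydisc_nbhs.
- pose h (z : M * R) := per p0 + (1 - z.2)%:C *: (per z.1 - per p0).
  exists p0, (s \o h); split.
  + by split=> //; exact: polydisc_center.
  + apply: continuous_in_subspaceT => -[q u]; rewrite inE => -[[/= Aq Dq] /=].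
    rewrite in_itv /= => /andP[u0 u1].
    apply: continuous_comp.
      apply: (@cvgD _ _ _ _ (nbhs_filter (q, u))); first exact: cvg_cst.
      apply: (@cvgZ _ _ _ _ (nbhs_filter (q, u))).
        apply: (cvg_comp (fun z : M * R => 1 - z.2) _ _ (@real_complex_continuous R (1 - u))).
        by apply: (@cvgB _ _ _ _ (nbhs_filter (q, u))); [exact: cvg_cst|exact: cvg_snd].
      apply: (@cvgB _ _ _ _ (nbhs_filter (q, u))); last exact: cvg_cst.
      exact: (cvg_comp (fun z : M * R => z.1) _ cvg_fst (pc q Aq)).
    have [|_ _ []//] := HB (h (q, u)).
    have [|//] := Hr (h (q, u)).
    by apply: polydisc_segment => //; apply: onem_ge0_le1; rewrite u0 u1.
  + move=> q u [Aq Dq] /andP[u0 u1].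
    have Dh : polydisc (per p0) r (h (q, u)).
      by apply: polydisc_segment => //; apply: onem_ge0_le1; rewrite u0 u1.
    have [Bh _] := Hr _ Dh; have [Ah hK _] := HB _ Bh.
    by split=> //=; rewrite hK.
  move=> q [Aq Dq]; rewrite /h /= subr0 scale1r subrKC subrr scale0r addr0 sx0.
  by have [_ -> _] := HA q Aq.
- by split=> //; exact: polydisc_center.
by move=> q [Aq Dq]; have [_ /=] := Hr _ Dq; have [_ -> _] := HA q Aq.
Qed.

(** A closed square in each period coordinate: a product of compact sets. *)
Lemma compact_nbhs (p0 : M) : exists2 F : set M, compact F & nbhs p0 F.
Proof.
have [s [A [B [oA oB Ap0 HA HB]]]] := mini p0.
have [Bx0 sx0 _] := HA _ Ap0.
have [r r0 Hr] : exists2 r : R, 0 < r & polydisc (per p0) r `<=` B.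
  by apply: nbhs_polydisc; exact: open_nbhs_nbhs.
exists (s @` polysquare (per p0) (r / 4)).
  apply: continuous_compact; last exact: polysquare_compact.
  apply: continuous_in_subspaceT => x; rewrite inE => /(polysquare_disc r0)/Hr/HB.
  by case=> _ _ [].
have r4 : 0 < r / 4 by lra.
have : \forall q \near p0, A q /\ polydisc (per p0) (r / 4) (per q).
  apply: filterI; first exact: open_nbhs_nbhs.
  have := mholo_continuous (let: And3 _ _ h := HA _ Ap0 in h).
  by apply; apply: polydisc_nbhs; exact: polydisc_center.
apply: filterS => q [Aq Dq]; exists (per q); first exact: polydisc_square.
by have [] := HA _ Aq.
Qed.

(** The paths are the segments from the centre of a polydisc in the period
    coordinates. *)
Lemma locally_path_connected (p0 : M) : \forall p \near p0, exists q : R -> M,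
  [/\ q 0 = p0, q 1 = p & forall u, 0 <= u <= 1 -> {for u, continuous q}].
Proof.
have [s [A [B [oA oB Ap0 HA HB]]]] := mini p0.
have [Bx0 sx0 _] := HA _ Ap0.
have [r r0 Hr] : exists2 r : R, 0 < r & polydisc (per p0) r `<=` B.
  by apply: nbhs_polydisc; exact: open_nbhs_nbhs.
have : \forall q \near p0, A q /\ polydisc (per p0) r (per q).
  apply: filterI; first exact: open_nbhs_nbhs.
  have := mholo_continuous (let: And3 _ _ h := HA _ Ap0 in h).
  by apply; apply: polydisc_nbhs; exact: polydisc_center.
apply: filterS => p [Ap Dp].
exists (fun u : R => s (per p0 + u%:C *: (per p - per p0))); split.
- by rewrite scale0r addr0.
- by rewrite scale1r subrKC; have [] := HA _ Ap.
move=> u u01; apply: (@continuous_comp _ _ _ (fun u : R => per p0 + u%:C *: (per p - per p0)) s).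
  apply: (@cvgD _ _ _ _ (nbhs_filter u)); first exact: cvg_cst.
  apply: (@cvgZ _ _ _ _ (nbhs_filter u)); last exact: cvg_cst.
  exact: real_complex_continuous.
by have [|_ _ []//] := HB (per p0 + u%:C *: (per p - per p0)); apply/Hr/polydisc_segment.
Qed.

End Manifold.

(** Both P and its complement are open in the connected interval [0, 1]. *)
Lemma segment_locally_constant (R : realType) (P : set R) :
  (forall u : R, 0 <= u <= 1 -> \forall v \near u, P v <-> P u) -> P 0 -> P 1.
Proof.
move=> H P0.
have I0 : (`[0, 1]%classic : set R) 0 by rewrite /= in_itv /= lexx ler01.
have PC (u : R) : 0 <= u <= 1 -> P u -> interior P u.
  by move=> /H Hu Pu; apply: filterS Hu => v ->.
have NC (u : R) : 0 <= u <= 1 -> ~ P u -> interior (~` P) u.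
  by move=> /H Hu Pu; apply: filterS Hu => v /= ->.
suff E : `[0, 1] `&` P = `[0, 1]%classic.
  have : (`[0, 1] `&` P) 1 by rewrite E /= in_itv /= ler01 lexx.
  by case.
apply: segment_connected.
- by exists 0.
- exists (interior P); first exact: open_interior.
  apply/seteqP; split=> u [u01 Pu]; split=> //; last exact: interior_subset.
  by apply: PC => //; move: u01; rewrite /= in_itv.
- exists (~` interior (~` P)); first by apply: open_closedC; exact: open_interior.
  apply/seteqP; split=> u [u01 Pu]; split=> //=.
    by move=> /interior_subset; exact.
  by apply: contrapT => nPu; apply/Pu/NC => //; move: u01; rewrite /= in_itv.
Qed.

(** * Local constancy of the BPS invariants *)

Section LocalConstancy.
Variables (R : realType) (L : zmodType) (n : nat) (g : 'I_n -> L).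
Variables (form : L -> L -> int) (N : 'rV[R]_n -> R).
Variables (M : complexManifold R) (V : M -> bps R L).
Hypotheses (gb : zbasis g) (skew : skew_form form) (Nn : is_norm N).
Hypotheses (framed : framed_variation g form N V) (mini : miniversal g V).
Hypotheses (finV : forall p, finite_bps (V p)).
Hypotheses (unV : forall p, uncoupled_bps form (V p)).
Local Notation C := R[i].
Implicit Types (p q : M) (a c d : L).

Lemma Zch_continuous c p : {for p, continuous (fun q => Zch (V q) c)}.
Proof. by case: framed => _ hZ _ _; apply: mholo_continuous. Qed.

Lemma cmod_Zch_continuous c p : {for p, continuous (fun q => cmod (Zch (V q) c))}.
Proof.
apply: (@continuous_comp _ _ _ (fun q => Zch (V q) c) (@cmod R : C -> R)).
  exact: Zch_continuous.
exact: cmod_continuous.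
Qed.

Lemma local_support_bound p : exists2 K : R, 0 < K &
  \forall q \near p, support_bound g N (V q) K.
Proof.
have [F cF nF] := compact_nbhs mini p.
case: framed => _ _ /(_ F cF)[K [K0 HK]] _; exists K => //.
exact: filterS nF.
Qed.

Lemma Omega_inactive (B : bps R L) (K : R) c : support_bound g N B K ->
  cmod (Zch B c) <= K * lnorm g N c -> Omega B c = 0.
Proof.
move=> HB le; apply/eqP; apply: contraTT le => Bc; rewrite -ltNge.
exact: HB.
Qed.

(** The set of classes whose constancy is the hypothesis of the wall-crossing
    formula. *)
Definition region (t k K T : R) q : set L :=
  [set c | sector_gens g N (V q) (sector (sector_itv t k)) K c /\
           cmod (Zch (V q) c) < T].

(** A class in the region has norm at most T / K, so only finitely many
    classes matter, whatever the point. For each of these the conditions that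
    define the region compare continuous functions of the point. A class with
    |Z(c)| < K ||c|| at p stays out of the region near p; for the other ones
    the genericity of K, T and k excludes equality in all comparisons at p. *)
Lemma near_region (t k K0 K T T1 : R) p : 0 < k -> k < 1 -> 0 < K0 ->
  K0 / 2 < K -> T < T1 ->
  (forall c, lnorm g N c <= 2 * T1 / K0 -> c != 0 ->
     [/\ K != cmod (Zch (V p) c) / lnorm g N c, T != cmod (Zch (V p) c) &
      k != `|complex.Im (Zch (V p) c * cis (- t))| /
           complex.Re (Zch (V p) c * cis (- t))]) ->
  \forall q \near p, region t k K T q = region t k K T p.
Proof.
move=> k0 k1 K00 KK0 TT1 gen.
have K_gt0 : 0 < K by apply: lt_trans KK0; lra.
have bounded q c : region t k K T q c -> lnorm g N c <= 2 * T1 / K0 /\ c != 0.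
  move=> [[_ h1] h2].
  have l0 := @lnorm_ge0 R L n g N Nn c.
  split.
    rewrite ler_pdivlMr //.
    have : K0 / 2 * lnorm g N c <= K * lnorm g N c by rewrite ler_wpM2r // ltW.
    lra.
  apply: contraTneq h1 => c0; rewrite -leNgt c0 raddf0 cmod0 mulr_ge0 //.
    exact: ltW.
  exact: (@lnorm_ge0 R L n g N Nn 0).
suff H : \forall q \near p, forall c, [set c | lnorm g N c <= 2 * T1 / K0] c ->
    (region t k K T q c <-> region t k K T p c).
  apply: filterS H => q Hq; apply/seteqP; split=> c Hc.
    by apply/Hq => //; have [] := bounded q c Hc.
  by apply/Hq => //; have [] := bounded p c Hc.
apply: near_finite; first exact: finite_lnorm_le.
move=> c /= cle; have [->|c0] := eqVneq c 0.
  by near=> q; split=> /bounded[_]; rewrite eqxx.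
have [gK gT gk] := gen c cle c0.
have l0 : 0 < lnorm g N c by exact: lnorm_gt0.
have cK : {for p, continuous (fun q => K * lnorm g N c)} by exact: cvg_cst.
have cT : {for p, continuous (fun q : M => T)} by exact: cvg_cst.
have cZ := @cmod_Zch_continuous c p.
have neK : K * lnorm g N c != cmod (Zch (V p) c).
  by apply: contra_neq gK => <-; rewrite mulfK // gt_eqF.
have nearK := near_lt_eq cK cZ neK.
case: (ltgtP (K * lnorm g N c) (cmod (Zch (V p) c))) neK => // KZ _; last first.
  apply: filterS nearK => q Eq; rewrite [in RHS](ltNge (K * _)) (ltW KZ) /= in Eq.
  split=> -[[_ +] _]; first by rewrite Eq.
  by rewrite ltNge (ltW KZ).
have nearT := near_lt_eq cZ cT (_ : _ != T).
have {}nearT : \forall q \near p, (cmod (Zch (V q) c) < T) = (cmod (Zch (V p) c) < T).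
  by apply: nearT; rewrite eq_sym.
set v := fun q => Zch (V q) c * cis (- t).
have cv : {for p, continuous v}.
  by apply: (@cvgM _ _ _ (nbhs_filter p)); [exact: Zch_continuous|exact: cvg_cst].
have cI : {for p, continuous (fun q => `|complex.Im (v q)|)}.
  apply: (@continuous_comp _ _ _ (fun q => complex.Im (v q)) (fun x : R => `|x|)).
    by apply: (continuous_comp cv); exact: Im_continuous.
  exact: norm_continuous.
have cR : {for p, continuous (fun q => k * complex.Re (v q))}.
  apply: (@cvgM _ _ _ (nbhs_filter p)); first exact: cvg_cst.
  by apply: (continuous_comp cv); exact: Re_continuous.
have v0 : v p != 0.
  rewrite -cmod_gt0 cmodM cmod_cis mulr1.
  by apply: lt_trans KZ; rewrite mulr_gt0.
have nev : `|complex.Im (v p)| != k * complex.Re (v p).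
  apply/eqP => E; have [r0|r0] := eqVneq (complex.Re (v p)) 0.
    move/eqP: v0; apply; apply: complex_ext => //=.
    by apply/eqP; rewrite -normr_eq0 E r0 mulr0.
  by move/eqP: gk; apply; rewrite -/(v p) E mulfK.
apply: filterS3 nearK nearT (near_lt_eq cI cR nev) => q EK ET Ev.
have sec : sector (sector_itv t k) (Zch (V q) c) <-> sector (sector_itv t k) (Zch (V p) c).
  by rewrite !sector_slope // /slope_sector /= -/(v q) -/(v p) Ev.
by rewrite /region /sector_gens /= EK ET sec.
Unshelve. all: by end_near. Qed.

(** If K ||c|| > |Z(c)| at p, the class c is inactive near p. Otherwise the
    wall-crossing formula applies to a narrow sector around the ray of Z(c)
    and a small contractible neighbourhood of p. It says that DT is constant
    at the classes of that sector of charge less than T, in particular at c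
    and at all its divisors, which determine Omega(c). *)
Lemma Omega_locally_constant c p : \forall q \near p, Omega (V q) c = Omega (V p) c.
Proof.
have [K0 K00 HK0] := local_support_bound p.
have HKp := nbhs_singleton HK0.
have [->|c0] := eqVneq c 0.
  apply: filterS HK0 => q Hq; rewrite (Omega_inactive Hq) ?(Omega_inactive HKp) //.
    by rewrite raddf0 cmod0 mulr_ge0 ?lnorm_ge0 // ltW.
  by rewrite raddf0 cmod0 mulr_ge0 ?lnorm_ge0 // ltW.
have l0 : 0 < lnorm g N c by exact: lnorm_gt0.
set m := cmod (Zch (V p) c).
have m0 : 0 <= m := cmod_ge0 _.
pose T1 := m + 1.
have Ffin : finite_set [set c | lnorm g N c <= 2 * T1 / K0] by exact: finite_lnorm_le.
have [K [K1 K2 genK]] := @avoid_image R L _ (fun c => cmod (Zch (V p) c) / lnorm g N c)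
  (K0 / 2) K0 Ffin (ltac:(lra)).
have [T [mT TT1 genT]] := @avoid_image R L _ (fun c => cmod (Zch (V p) c))
  m T1 Ffin (ltac:(rewrite /T1; lra)).
have K_gt0 : 0 < K by apply: lt_trans K1; lra.
have HK : \forall q \near p, support_bound g N (V q) K.
  by apply: filterS HK0 => q; apply: support_bound_le => //; exact: ltW.
case: (ltP m (K * lnorm g N c)) => [mK|].
  have nK := @cvgr_lt _ _ _ (nbhs_filter p) _ _ (@cmod_Zch_continuous c p) _ mK.
  have HK' := nbhs_singleton HK; apply: filterS2 HK nK => q Hq nq.
  rewrite (Omega_inactive Hq (ltW nq)) (Omega_inactive HK') //.
  exact: ltW.
rewrite le_eqVlt => /orP[/eqP Em|Km].
  (* The choice of K avoids this value. *)
  have KE : m / lnorm g N c = K by rewrite -Em mulfK // gt_eqF.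
  have := genK c; rewrite /= -/m KE eqxx => /(_ _)/negP[] //.
  have : K0 / 2 * lnorm g N c <= m by rewrite -Em ler_wpM2r // ltW.
  by rewrite ler_pdivlMr // /T1; lra.
have Z0 : Zch (V p) c != 0 by rewrite -cmod_gt0 -/m; apply: lt_trans Km; rewrite mulr_gt0.
pose t := carg (Zch (V p) c).
have [k [k0 k1 genk]] := @avoid_image R L _
  (fun c => `|complex.Im (Zch (V p) c * cis (- t))| /
           complex.Re (Zch (V p) c * cis (- t))) 0 1 Ffin ltr01.
have nreg : \forall q \near p, region t k K T q = region t k K T p.
  apply: (@near_region t k K0 K T T1) => // d dle d0.
  by split; [exact: genK|exact: genT|exact: genk].
have [A [oA cA Ap AP]] := small_contractible mini (filterI HK nreg).
have regc : region t k K T p c.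
  split=> //; split=> //; rewrite sector_slope // /slope_sector /=.
  rewrite [Zch (V p) c]cis_carg // -/t -mulrA [cis t * _]mulrC cisN mulr1 /=.
  by rewrite normr0 mulr_gt0 // cmod_gt0.
apply: filterS (open_nbhs_nbhs (conj oA Ap)) => q Aq.
have T_gt0 : 0 < T by exact: le_lt_trans mT.
have a0 : 0 < atan k by rewrite -[ltLHS]atan0 lt_atan.
have regq q' : A q' -> region t k K T q' c.
  by move=> /AP[_ ->].
have DTeq d m' : (0 < m')%N -> c = d *+ m' -> DT (V q) d = DT (V p) d.
  move=> m'0 cd.
  have prod q' : A q' -> clockwise_product g form N (V q') (sector_itv t k) K T d =
      - ratr (DT (V q') d).
    move=> Aq'; have [[sq' _] Tq'] := regq q' Aq'.
    apply: clockwise_product_uncoupled => //.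
    - by move=> x y z; exact: sector_ray_inj.
    - move: sq'; rewrite !sector_slope // cd raddfMn.
      exact: slope_sectorMn.
    by apply: le_lt_trans Tq'; rewrite cd raddfMn cmodMn.
  case: framed => _ _ _ /(_ A K T (t - atan k) (t + atan k) false true) wc.
  have E : clockwise_product g form N (V q) (sector_itv t k) K T =
      clockwise_product g form N (V p) (sector_itv t k) K T.
    apply: (wc oA cA K_gt0 T_gt0) => //.
    - by move=> q' /AP[].
    - by lra.
    - exact: sector_itv_acute.
    by move=> q1 q2 /AP[_ E1] /AP[_ E2]; rewrite -!/(region t k K T _) E1 E2.
  have : - ratr (DT (V q) d) = - ratr (DT (V p) d) :> C by rewrite -!prod // E.
  by move/oppr_inj/fmorph_inj.
exact: Omega_of_DT gb c0 DTeq.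
Qed.

(** The neighbourhood in the previous lemma depends on the class. Constancy
    along paths removes this dependence. *)
Lemma Omega_near_constant p : \forall q \near p, forall c, Omega (V q) c = Omega (V p) c.
Proof.
apply: filterS (locally_path_connected mini p) => q [f [f0 f1 cf]] c.
pose P := [set u : R | Omega (V (f u)) c = Omega (V p) c].
have : P 1; last by rewrite /P /= f1.
apply: segment_locally_constant; last by rewrite /P /= f0.
move=> u u01.
have : \forall v \near u, Omega (V (f v)) c = Omega (V (f u)) c.
  exact: cf u u01 _ (Omega_locally_constant c (f u)).
by apply: filterS => v E; rewrite /P /= E.
Qed.

End LocalConstancy.

(** * Logarithmic derivatives *)

Section LogDerivative.
Variables (K : numFieldType) (V : normedModType K).
Implicit Types (f g : V -> K) (x v : V) (l m : K).

(** The condition f' / f = l in the direction v, together with the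
    nonvanishing of f that gives it a meaning. *)
Definition log_derivative f x v l : Prop :=
  f x != 0 /\ is_derive x v f (l * f x).

Lemma log_derivative_cst1 x v : log_derivative (fun=> 1) x v 0.
Proof. by split; [exact: oner_neq0|rewrite mul0r; exact: dC_cst]. Qed.

Lemma log_derivativeM f g x v l m : log_derivative f x v l ->
  log_derivative g x v m -> log_derivative (fun y => f y * g y) x v (l + m).
Proof.
move=> [f0 Df] [g0 Dg]; split; first by rewrite mulf_neq0.
by apply: is_derive_eqd (dC_mul Df Dg) _; ring.
Qed.

Lemma log_derivativeV f x v l : log_derivative f x v l ->
  log_derivative (fun y => (f y)^-1) x v (- l).
Proof.
move=> [f0 [fd fE]]; split; first by rewrite invr_neq0.
apply: DeriveDef; first exact: derivableV.
rewrite deriveV // fE -[_ *: _]/(_ * _); field.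
by [].
Qed.

Lemma log_derivativeX f x v l n : log_derivative f x v l ->
  log_derivative (fun y => f y ^+ n) x v (n%:R * l).
Proof.
move=> Hf; elim: n => [|n IH].
  by rewrite mul0r; exact: log_derivative_cst1.
have := log_derivativeM Hf IH; rewrite (_ : l + n%:R * l = n.+1%:R * l); last first.
  by rewrite -natr1; ring.
move=> H; rewrite (_ : (fun y => f y ^+ n.+1) = fun y => f y * f y ^+ n) //.
by apply/funext => y; rewrite exprS.
Qed.

Lemma log_derivative_exprz f x v l (k : int) : log_derivative f x v l ->
  log_derivative (fun y => f y ^ k) x v (k%:~R * l).
Proof.
move=> Hf; case: k => k; first exact: log_derivativeX.
rewrite NegzE mulrNz mulNr; exact: log_derivativeV (log_derivativeX k.+1 Hf).
Qed.

Lemma log_derivative_prod (I : eqType) (s : seq I) (F : I -> V -> K) x v (l : I -> K) :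
  (forall a, a \in s -> log_derivative (F a) x v (l a)) ->
  log_derivative (fun y => \prod_(a <- s) F a y) x v (\sum_(a <- s) l a).
Proof.
elim: s => [|a s IH] H.
  rewrite big_nil (_ : (fun y => _) = fun=> 1); last first.
    by apply/funext => y; rewrite big_nil.
  exact: log_derivative_cst1.
rewrite big_cons (_ : (fun y => _) = fun y => F a y * \prod_(a <- s) F a y); last first.
  by apply/funext => y; rewrite big_cons.
apply: log_derivativeM; first by apply: H; rewrite mem_head.
by apply: IH => b bs; apply: H; rewrite inE bs orbT.
Qed.

Lemma differentiable_exprz f x (k : int) : f x != 0 ->
  differentiable f x -> differentiable (fun y => f y ^ k) x.
Proof.
move=> f0 Df; have DX n : differentiable (fun y => f y ^+ n) x.
  case: n => [|n].
    rewrite (_ : (fun y => f y ^+ 0) = cst 1); first exact: differentiable_cst.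
    by apply/funext => y; rewrite expr0.
  rewrite (_ : (fun y => f y ^+ n.+1) = f ^+ n.+1); first exact: differentiableX.
  by apply/funext => y; rewrite exprfctE.
case: k => k; first exact: DX.
by apply: (differentiableV (DX k.+1)); rewrite expf_neq0.
Qed.

Lemma differentiable_prod (I : eqType) (s : seq I) (F : I -> V -> K) x :
  (forall a, a \in s -> differentiable (F a) x) ->
  differentiable (fun y => \prod_(a <- s) F a y) x.
Proof.
elim: s => [|a s IH] H.
  rewrite (_ : (fun y => _) = cst 1); first exact: differentiable_cst.
  by apply/funext => y; rewrite big_nil.
rewrite (_ : (fun y => _) = F a * (fun y => \prod_(a <- s) F a y)); last first.
  by apply/funext => y; rewrite big_cons.
apply: differentiableM; first by apply: H; rewrite mem_head.
by apply: IH => b bs; apply: H; rewrite inE bs orbT.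
Qed.

Lemma near_eq_differentiable f g x : (\forall y \near x, f y = g y) ->
  differentiable f x -> differentiable g x.
Proof.
move=> fg /diff_locallyP[cf /eqaddoP Hf].
have fgx := nbhs_singleton fg.
have Hg : g \o shift x = cst (g x) + 'd f x +o_ 0 id.
  apply/eqaddoP => e e0; have := Hf e e0.
  have : \forall h \near (0 : V), f (h + x) = g (h + x).
    by move: fg; rewrite (near_shift 0); apply: filterS => h /=; rewrite subr0.
  apply: filterS2 => h E; rewrite /= /shift /= fctE /= => H.
  by move: H; rewrite -!/(_ h) /= !fctE /= /shift /= -E -fgx.
have dE := diff_unique cf Hg.
by apply/diff_locallyP; rewrite dE.
Qed.

End LogDerivative.

Lemma log_derivative_comp (K : numFieldType) (V : normedModType K) (F : K -> K)
    (f : V -> K) (x v : V) (l d : K) : is_derive x v f d ->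
  log_derivative F (f x) 1 l -> log_derivative (F \o f) x v (l * d).
Proof.
move=> Df [F0 DF]; split=> //.
by apply: is_derive_eqd (is_derive_comp Df DF) _; rewrite /=; ring.
Qed.

(** * The half-planes of a ray *)

Section HalfPlanes.
Variable R : realType.
Local Notation C := R[i].
Implicit Types (w z t l : C) (r : set C).

Lemma complexiC : 'i%C = ('i : C).
Proof. exact: complexiE. Qed.

Lemma half_planeP z w : z != 0 ->
  half_plane (ray_of z) w <-> 0 < complex.Re (w / z).
Proof.
move=> z0; split.
  move=> [_ [v [[x [x0 ->]] v0 ->]]].
  rewrite mulrAC mulfK // cReM /= mul0r subr0 mulr_gt0 //.
move=> w0; exists z, (w / z); split=> //; last by rewrite mulrC divfK.
by exists 1; rewrite ltr01 mul1r.
Qed.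

Lemma rotated_half_planeP z w : z != 0 ->
  dilate 'i (half_plane (ray_of z)) w <-> 0 < complex.Im (w / z).
Proof.
move=> z0; have iE (u : C) : complex.Im ('i * u) = complex.Re u.
  by rewrite -complexiC cImM /= mul0r add0r mul1r.
have i0 : ('i : C) != 0 by exact: neq0Ci.
split.
  by move=> [u /(half_planeP u z0) u0 <-]; rewrite -mulrA iE.
move=> w0; exists (w / 'i); last by rewrite mulrC divfK.
apply/half_planeP => //; rewrite -iE; have -> : 'i * (w / 'i / z) = w / z by field; rewrite i0 z0.
by [].
Qed.

Lemma dilate_ray l z : dilate l (ray_of z) = ray_of (l * z).
Proof.
apply/seteqP; split=> w.
  by move=> [_ [x [x0 ->]] <-]; exists x; split=> //; rewrite mulrCA.
by move=> [x [x0 ->]]; exists (x%:C * z); [exists x|rewrite mulrCA].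
Qed.

(** If u = w / (2 pi i t) were real and nonpositive, then w / z, which is 2 pi
    i u (t / z), would have a nonpositive imaginary part. *)
Lemma arg_slit z w t : z != 0 -> 0 < complex.Im (w / z) -> 0 < complex.Re (t / z) ->
  slit (w / (2 * pi%:C * 'i * t)).
Proof.
move=> z0 w0 t0; set u := w / _; have pi0 := pi_gt0 R.
have tz : t != 0.
  by apply: contraTneq t0 => ->; rewrite mul0r /= ltxx.
have p0 : (pi%:C : C) != 0 by rewrite -cmod_gt0 cmod_real normr_gt0 gt_eqF.
have i0 : ('i : C) != 0 by exact: neq0Ci.
have E : w / z = 'i * ((2 * pi)%:C * (u * (t / z))).
  have -> : (2 * pi)%:C = 2 * pi%:C :> C by rewrite rmorphM rmorph_nat.
  rewrite /u; move: (pi%:C : C) p0 => P p0.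
  by field; rewrite tz p0 i0 z0.
have iE (y : C) : complex.Im ('i * y) = complex.Re y.
  by rewrite -complexiC cImM /= mul0r add0r mul1r.
move: w0; rewrite E iE cReM /= mul0r subr0 pmulr_rgt0 ?mulr_gt0 // cReM.
have [u0|u0 _] := eqVneq (complex.Im u) 0; last by right.
by rewrite u0 mul0r subr0 pmulr_lgt0 //; left.
Qed.

End HalfPlanes.

(** * The tau-function *)

Section ProductProjections.
Variables (K : numFieldType) (V W : normedModType K).

Lemma differentiable_fst (u : V * W) : differentiable (fst : V * W -> V) u.
Proof. by apply: linear_differentiable => v; exact: cvg_fst. Qed.

Lemma differentiable_snd (u : V * W) : differentiable (snd : V * W -> W) u.
Proof. by apply: linear_differentiable => v; exact: cvg_snd. Qed.

End ProductProjections.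

Section Tau.
Variables (R : realType) (L : zmodType) (n : nat) (g : 'I_n -> L).
Variables (form : L -> L -> int) (N : 'rV[R]_n -> R).
Variables (M : complexManifold R) (V : M -> bps R L).
Hypotheses (gb : zbasis g) (skew : skew_form form) (Nn : is_norm N).
Hypotheses (framed : framed_variation g form N V) (mini : miniversal g V).
Hypotheses (finV : forall p, finite_bps (V p)).
Hypotheses (unV : forall p, uncoupled_bps form (V p)).
Local Notation C := R[i].
Implicit Types (p q : M) (a c : L).
Variable z0 : C.
Hypothesis z00 : z0 != 0.
Local Notation r := (ray_of z0).

Definition normalized (Z t : C) : C := Z / (2 * pi%:C * 'i * t).

Lemma finite_right_classes p r' : finite_set (right_classes (V p) r').
Proof. by apply: sub_finite_set (finV p) => a []. Qed.

Definition right_seq p : seq L := enum_fset (fset_set (right_classes (V p) r)).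

Lemma mem_right_seq p a : a \in right_seq p <-> right_classes (V p) r a.
Proof.
by rewrite /right_seq in_fset_set ?inE //; exact: finite_right_classes.
Qed.

Lemma tau_funE p t : tau_fun (V p) r t =
  \prod_(a <- right_seq p) Upsilon (normalized (Zch (V p) a) t) ^ numq (Omega (V p) a).
Proof. by rewrite /tau_fun fsbig_finite //; exact: finite_right_classes. Qed.

Lemma Y_funE p c t : Y_fun form (V p) r c t =
  \prod_(a <- right_seq p) Lambda (normalized (Zch (V p) a) t) ^
    (numq (Omega (V p) a) * form c a).
Proof. by rewrite /Y_fun fsbig_finite //; exact: finite_right_classes. Qed.

Lemma right_seq_slit p t a : half_plane r t -> a \in right_seq p ->
  slit (normalized (Zch (V p) a) t).
Proof.
move=> /(half_planeP _ z00) t0 /mem_right_seq[_ /(rotated_half_planeP _ z00) a0].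
exact: arg_slit z00 a0 t0.
Qed.

Lemma half_plane_near t : half_plane r t -> \forall s \near t, half_plane r s.
Proof.
move=> /(half_planeP _ z00) t0.
have ct : {for t, continuous (fun s : C => complex.Re (s / z0))}.
  apply: (@continuous_comp _ _ _ (fun s : C => s / z0) (@complex.Re R : C -> R)).
    by apply: (@cvgM _ _ _ (nbhs_filter t)); [exact: cvg_id|exact: cvg_cst].
  exact: Re_continuous.
have := @cvgr_gt _ _ _ (nbhs_filter t) _ _ ct _ t0.
by apply: filterS => s s0; apply/half_planeP.
Qed.

(** The boundary of the rotated half-plane is the line through r. If an active
    class were on it, then the class or its opposite, which is active too,
    would lie on r; the central charge of an active class is nonzero by the
    support property. *)
Lemma active_Im_neq0 p a : ~ active_ray (V p) r -> active (V p) a ->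
  complex.Im (Zch (V p) a / z0) != 0.
Proof.
move=> nact Aa; case: framed => /(_ p)[sym [K [K0 HK]]] _ _ _.
have Za : 0 < cmod (Zch (V p) a).
  apply: le_lt_trans (HK a Aa); rewrite mulr_ge0 ?lnorm_ge0 //; exact: ltW.
apply/eqP => Im0; set x := complex.Re (Zch (V p) a / z0).
have Zx : Zch (V p) a = x%:C * z0.
  by rewrite -[LHS](divfK z00); congr (_ * _); exact: complex_ext.
case: (ltgtP 0 x) => x0.
- by apply: nact; exists a; split=> //; exists x.
- apply: nact; exists (- a); split; first by rewrite /active /= sym.
  exists (- x); rewrite oppr_gt0; split=> //.
  by rewrite raddfN Zx rmorphN mulNr.
by move: Za; rewrite Zx -x0 mul0r cmod0 ltxx.
Qed.

(** The invariants are constant near p, and no active class is on the boundary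
    of the half-plane that selects the factors. *)
Lemma near_right_classes p : ~ active_ray (V p) r ->
  \forall q \near p, right_classes (V q) r = right_classes (V p) r /\
    forall c, Omega (V q) c = Omega (V p) c.
Proof.
move=> nact.
have H1 := Omega_near_constant gb skew Nn framed mini finV unV p.
have H2 : \forall q \near p, forall a, active (V p) a ->
    (0 < complex.Im (Zch (V q) a / z0)) = (0 < complex.Im (Zch (V p) a / z0)).
  apply: near_finite => [|a Aa]; first exact: finV.
  apply: near_lt_eq; first exact: cvg_cst.
    apply: (@continuous_comp _ _ _ (fun q => Zch (V q) a / z0) (@complex.Im R : C -> R)).
      apply: (@cvgM _ _ _ (nbhs_filter p)); last exact: cvg_cst.
      exact: (Zch_continuous framed).
    exact: Im_continuous.
  by rewrite eq_sym active_Im_neq0.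
apply: filterS2 H1 H2 => q EO EI; split=> //; apply/seteqP; split=> a [Aa].
  move=> /(rotated_half_planeP _ z00) Ia; have Aa' : active (V p) a by rewrite /active /= -EO.
  by split=> //; apply/rotated_half_planeP => //; rewrite -EI.
move=> /(rotated_half_planeP _ z00) Ia; split; first by rewrite /active /= EO.
by apply/rotated_half_planeP => //; rewrite EI.
Qed.

Lemma near_tau_funE p : ~ active_ray (V p) r -> \forall q \near p, forall t,
  tau_fun (V q) r t = \prod_(a <- right_seq p)
    Upsilon (normalized (Zch (V q) a) t) ^ numq (Omega (V p) a).
Proof.
move=> /near_right_classes; apply: filterS => q [E EO] t.
by rewrite tau_funE /right_seq E; apply: eq_bigr => a _; rewrite EO.
Qed.

Lemma near_right_seq_slit p : ~ active_ray (V p) r -> \forall q \near p, forall t a,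
  half_plane r t -> a \in right_seq p -> slit (normalized (Zch (V q) a) t).
Proof.
move=> /near_right_classes; apply: filterS => q [E _] t a rt ap.
by apply: right_seq_slit => //; rewrite /right_seq E.
Qed.

Lemma tau_fun_neq0 p t : half_plane r t -> tau_fun (V p) r t != 0.
Proof.
move=> rt; rewrite tau_funE prodf_seq_neq0; apply/allP => a ap /=.
by apply/expfz_neq0/Upsilon_neq0; exact: right_seq_slit.
Qed.

Lemma tau_fun_rescale (l : C) p t : l != 0 -> half_plane r t ->
  tau_fun (rescale l (V p)) (dilate l r) (l * t) = tau_fun (V p) r t.
Proof.
move=> l0 rt; have lz0 : l * z0 != 0 by rewrite mulf_neq0.
have tn0 : t != 0.
  by apply: contraTneq ((half_planeP _ z00).1 rt) => ->; rewrite mul0r /= ltxx.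
have p0 : (pi%:C : C) != 0 by rewrite -cmod_gt0 cmod_real normr_gt0 gt_eqF // pi_gt0.
rewrite /tau_fun dilate_ray.
have -> : right_classes (rescale l (V p)) (ray_of (l * z0)) = right_classes (V p) r.
  apply/seteqP; split=> a [Aa].
    move=> /(rotated_half_planeP _ lz0) /= Ia; split=> //.
    by apply/rotated_half_planeP => //; move: Ia; rewrite -mulf_div mulfV // mul1r.
  move=> /(rotated_half_planeP _ z00) /= Ia; split=> //.
  by apply/rotated_half_planeP => //=; rewrite -mulf_div mulfV // mul1r.
apply: eq_fsbigr => a _ /=; congr (Upsilon _ ^ _).
move: (pi%:C : C) p0 => P p0.
by field; rewrite neq0Ci p0 tn0 l0.
Qed.

Lemma differentiable_Upsilon (w : C) : slit w -> differentiable (@Upsilon R) w.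
Proof. by move=> /is_derive_Upsilon[D _]; apply/derivable1_diffP. Qed.

(** Near (p, t) the function is a product over a fixed finite set of classes,
    with fixed exponents. *)
Lemma tau_fun_mholo2 p t : half_plane r t -> ~ active_ray (V p) r ->
  mholo2 (fun q s => tau_fun (V q) r s) p t.
Proof.
move=> rt nact c ac cp; have [oc _ cK cc ci] := atlas_chart ac.
pose x0 := cfun c p.
have cx0 : {for x0, continuous (cinv c)} by apply: ci; exists p.
have fstc : (fun u : 'rV[C]_(mdim M) * C => cinv c u.1) @ (x0, t) --> p.
  rewrite -[X in _ --> X](cK p cp).
  exact: (cvg_comp (fun u : 'rV[C]_(mdim M) * C => u.1) _ cvg_fst cx0).
have H1 : \forall u \near ((x0, t) : 'rV[C]_(mdim M) * C), forall s,
    tau_fun (V (cinv c u.1)) r s = \prod_(a <- right_seq p)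
      Upsilon (normalized (Zch (V (cinv c u.1)) a) s) ^ numq (Omega (V p) a).
  exact: fstc _ (near_tau_funE nact).
have H2 : \forall u \near ((x0, t) : 'rV[C]_(mdim M) * C), forall s a,
    half_plane r s -> a \in right_seq p ->
    slit (normalized (Zch (V (cinv c u.1)) a) s).
  exact: fstc _ (near_right_seq_slit nact).
have H3 : \forall u \near ((x0, t) : 'rV[C]_(mdim M) * C), half_plane r u.2.
  by apply: cvg_snd; exact: half_plane_near.
have H4 : \forall u \near ((x0, t) : 'rV[C]_(mdim M) * C), forall a,
    [set a | a \in right_seq p] a -> differentiable (fun x => Zch (V (cinv c x)) a) u.1.
  apply: near_finite => [|a _]; first exact: finite_seq.
  have hZ : holomorphic_at ((fun q => Zch (V q) a) \o cinv c) x0.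
    by case: framed => _ /(_ a p) hZ _ _; exact: hZ.
  exact: cvg_fst hZ.
(* Q holds near (x0, t), hence near every point of a neighbourhood; at such a
   point the product formula can be differentiated. *)
pose Q (u : 'rV[C]_(mdim M) * C) := [/\ forall s, tau_fun (V (cinv c u.1)) r s =
    \prod_(a <- right_seq p)
      Upsilon (normalized (Zch (V (cinv c u.1)) a) s) ^ numq (Omega (V p) a),
    forall s a, half_plane r s -> a \in right_seq p ->
      slit (normalized (Zch (V (cinv c u.1)) a) s), half_plane r u.2 &
    forall a, [set a | a \in right_seq p] a ->
      differentiable (fun x : 'rV[C]_(mdim M) => Zch (V (cinv c x)) a) u.1].
have HQ : nbhs ((x0, t) : 'rV[C]_(mdim M) * C) Q.
  have Fx := nbhs_filter ((x0, t) : 'rV[C]_(mdim M) * C).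
  have H12 := @filterI _ _ Fx _ _ H1 H2; have H34 := @filterI _ _ Fx _ _ H3 H4.
  apply: (@filterS2 _ _ Fx _ _ _ _ H12 H34) => u [u1 u2] [u3 u4].
  by split.
rewrite /holomorphic_at.
have HI := nbhs_interior HQ.
apply: (@filterS _ _ (nbhs_filter _) _ _ _ HI) => y yQ.
have {}yQ : \forall u \near y, Q u by exact: yQ.
have [_ y2 y3 y4] := nbhs_singleton yQ.
have E : \forall u \near y, \prod_(a <- right_seq p)
    Upsilon (normalized (Zch (V (cinv c u.1)) a) u.2) ^ numq (Omega (V p) a) =
    tau_fun (V (cinv c u.1)) r u.2.
  apply: (@filterS _ _ (nbhs_filter y) _ _ _ yQ) => u [Hu _ _ _].
  exact: esym (Hu u.2).
apply: (near_eq_differentiable E).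
apply: differentiable_prod => a ap.
have sa := y2 _ _ y3 ap.
apply: differentiable_exprz; first exact: Upsilon_neq0.
apply: (@differentiable_comp _ _ _ _
  (fun u => normalized (Zch (V (cinv c u.1)) a) u.2) (@Upsilon R)); last first.
  exact: differentiable_Upsilon.
have y20 : y.2 != 0.
  by apply: contraTneq ((half_planeP _ z00).1 y3) => ->; rewrite mul0r /= ltxx.
have p0 : (pi%:C : C) != 0 by rewrite -cmod_gt0 cmod_real normr_gt0 gt_eqF // pi_gt0.
apply: differentiableM.
  apply: (@differentiable_comp _ _ _ _ fst (fun x => Zch (V (cinv c x)) a)); last exact: y4.
  exact: differentiable_fst.
apply: (@differentiableV _ _ (fun u : 'rV[C]_(mdim M) * C => 2 * pi%:C * 'i * u.2)); last first.
  by rewrite !mulf_neq0 // neq0Ci.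
apply: differentiableM; first exact: differentiable_cst.
exact: differentiable_snd.
Qed.

Lemma is_derive_normalized (Z t : C) : t != 0 ->
  is_derive t 1 (normalized Z) (- normalized Z t / t).
Proof.
move=> t0; have Dt : log_derivative (fun s : C => s) t 1 t^-1.
  by split=> //; rewrite mulVf //; exact: dC_id.
have [_ Dv] := log_derivativeV Dt.
rewrite (_ : normalized Z = fun s => (Z / (2 * pi%:C * 'i)) * s^-1); last first.
  by apply/funext => s; rewrite /normalized invfM mulrA.
apply: is_derive_eqd (dC_scale _ Dv) _.
by move: (Z / (2 * pi%:C * 'i)) => X /=; field.
Qed.

Lemma half_plane_neq0 t : half_plane r t -> t != 0.
Proof.
by move=> /(half_planeP _ z00); apply: contraTneq => ->; rewrite mul0r /= ltxx.
Qed.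

Lemma Y_fun_log_derivative p c t : half_plane r t ->
  log_derivative (Y_fun form (V p) r c) t 1
    (\sum_(a <- right_seq p) (numq (Omega (V p) a) * form c a)%:~R *
      (dlog_Lambda (normalized (Zch (V p) a) t) * (- normalized (Zch (V p) a) t / t))).
Proof.
move=> rt; rewrite (_ : Y_fun form (V p) r c = fun s => \prod_(a <- right_seq p)
    Lambda (normalized (Zch (V p) a) s) ^ (numq (Omega (V p) a) * form c a)); last first.
  by apply/funext => s; rewrite Y_funE.
apply: log_derivative_prod => a ap; apply: log_derivative_exprz.
have sa := right_seq_slit rt ap.
apply: (log_derivative_comp (is_derive_normalized _ (half_plane_neq0 rt))).
by split; [exact: Lambda_neq0|exact: is_derive_Lambda].
Qed.

(** The central charge of a as a function of the period coordinates. *)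
Definition linear_charge (a : L) (x : 'rV[C]_n) : C :=
  \sum_(k < n) x 0 k * (lcoord g a 0 k)%:~R.

Lemma Zch_period p a : Zch (V p) a = linear_charge a (period g V p).
Proof.
rewrite {1}(lcoordP gb a) raddf_sum; apply: eq_bigr => k _.
by rewrite raddfMz mxE mulrzr.
Qed.

Lemma is_derive_linear_charge a x i :
  is_derive x (delta_mx 0 i) (linear_charge a) (lcoord g a 0 i)%:~R.
Proof.
apply/is_derive_line.
rewrite (_ : (fun h => _) = fun h : C => h * (lcoord g a 0 i)%:~R + linear_charge a x).
  apply: is_derive_eqd (dC_add (dC_mul (dC_id _) (dC_cst _ _ _)) (dC_cst _ _ _)) _.
  by rewrite mul1r mulr0 !addr0.
apply/funext => h; rewrite /linear_charge.
have E k : (h *: delta_mx 0 i + x : 'rV[C]_n) 0 k = h * (k == i)%:R + x 0 k.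
  by rewrite !mxE eqxx.
transitivity (\sum_(k < n) (h * (k == i)%:R * (lcoord g a 0 k)%:~R +
    x 0 k * (lcoord g a 0 k)%:~R)).
  by apply: eq_bigr => k _; rewrite -mulrDl -E.
rewrite big_split /=; congr (_ + _).
rewrite (bigD1 i) //= eqxx mulr1 big1 ?addr0 // => k ki.
by rewrite (negbTE ki) mulr0 mul0r.
Qed.

Lemma tau_fun_log_derivative p t i : half_plane r t -> ~ active_ray (V p) r ->
  log_derivative (fun x => tau_fun (V (period_inv g V p x)) r t)
    (period g V p) (delta_mx 0 i)
    (\sum_(a <- right_seq p) (numq (Omega (V p) a))%:~R *
      (normalized (Zch (V p) a) t * dlog_Lambda (normalized (Zch (V p) a) t) *
       ((lcoord g a 0 i)%:~R / (2 * pi%:C * 'i * t)))).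
Proof.
move=> rt nact; set s := period_inv g V p; set x0 := period g V p.
have [A [B [oA oB Ap HA HB]]] : local_inverse (period g V) p s.
  exact: (xgetPex (fun=> p) (mini p)).
have [Bx0 sx0 _] := HA _ Ap; have [_ _ [cs _]] := HB _ Bx0.
have E : \forall x \near x0, \prod_(a <- right_seq p)
    Upsilon (normalized (linear_charge a x) t) ^ numq (Omega (V p) a) =
    tau_fun (V (s x)) r t.
  have E1 : \forall x \near x0, forall t, tau_fun (V (s x)) r t =
      \prod_(a <- right_seq p)
      Upsilon (normalized (Zch (V (s x)) a) t) ^ numq (Omega (V p) a).
    have H : nbhs (s x0) (fun q => forall t, tau_fun (V q) r t =
        \prod_(a <- right_seq p)
        Upsilon (normalized (Zch (V q) a) t) ^ numq (Omega (V p) a)).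
      by rewrite sx0; exact: near_tau_funE nact.
    exact: (cs _ H).
  have E2 := open_nbhs_nbhs (conj oB Bx0).
  apply: (@filterS2 _ _ (nbhs_filter x0) _ _ _ _ E1 E2) => x Ex Bx; rewrite Ex.
  apply: eq_bigr => a _; rewrite Zch_period.
  by have [_ -> _] := HB _ Bx.
have D : log_derivative (fun x => \prod_(a <- right_seq p)
    Upsilon (normalized (linear_charge a x) t) ^ numq (Omega (V p) a)) x0 (delta_mx 0 i)
    (\sum_(a <- right_seq p) (numq (Omega (V p) a))%:~R *
      (normalized (Zch (V p) a) t * dlog_Lambda (normalized (Zch (V p) a) t) *
       ((lcoord g a 0 i)%:~R / (2 * pi%:C * 'i * t)))).
  apply: log_derivative_prod => a ap; apply: log_derivative_exprz.
  have sa := right_seq_slit rt ap; rewrite Zch_period -/x0 in sa *.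
  have Dl : is_derive x0 (delta_mx 0 i) (fun x => normalized (linear_charge a x) t)
      ((lcoord g a 0 i)%:~R / (2 * pi%:C * 'i * t)).
    apply: is_derive_eqd (dC_mul (is_derive_linear_charge a x0 i) (dC_cst _ _ _)) _.
    by rewrite mulr0 addr0.
  apply: (log_derivative_comp Dl).
  by split; [exact: Upsilon_neq0|exact: is_derive_Upsilon].
have [D0 DD] := D; split; first by rewrite -(nbhs_singleton E).
by rewrite -(nbhs_singleton E); exact: near_eq_is_derive E DD.
Qed.

Lemma form_coord a c : form a c = \sum_(i < n) form (g i) c * lcoord g a 0 i.
Proof.
have form0 : form 0 c = 0 by have := formMnl skew 0 c 0; rewrite !mulr0n.
have formN x : form (- x) c = - form x c.
  by apply/eqP; rewrite -addr_eq0 -(formDl skew) addNr form0.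
have formMz x (m : int) : form (x *~ m) c = form x c * m.
  case: m => m; first by rewrite -pmulrn (formMnl skew) -mulr_natr natz.
  by rewrite NegzE mulrNz formN -pmulrn (formMnl skew) mulrN -mulr_natr natz.
rewrite {1}(lcoordP gb a).
have : forall s : seq 'I_n, form (\sum_(i <- s) g i *~ lcoord g a 0 i) c =
    \sum_(i <- s) form (g i) c * lcoord g a 0 i.
  elim=> [|i s IH]; first by rewrite !big_nil form0.
  by rewrite !big_cons (formDl skew) IH formMz.
exact.
Qed.

(** Write w = Z(a) / (2 pi i t) and a as the sum of the m_i g_i. On the left,
    the factor of a contributes - Omega(a) <g_j, a> w (log Lambda)'(w) / (2 pi
    i t). On the right it contributes Omega(a) w (log Lambda)'(w) / (2 pi i t)
    times the sum of the <g_i, g_j> m_i, which is <a, g_j> = - <g_j, a>. *)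
Lemma tau_equation p t j : half_plane r t -> ~ active_ray (V p) r ->
  [/\ derivable (Y_fun form (V p) r (g j)) t 1, Y_fun form (V p) r (g j) t != 0 &
    (2 * pi%:C * 'i)^-1 *
      (derive1 (Y_fun form (V p) r (g j)) t / Y_fun form (V p) r (g j) t) =
    \sum_(i < n) (form (g i) (g j))%:~R *
      (partial_z g V i (fun q => tau_fun (V q) r t) p / tau_fun (V p) r t)].
Proof.
move=> rt nact; have [Y0 [dY DY]] := Y_fun_log_derivative p (g j) rt.
split=> //; rewrite derive1E DY mulfK //.
have t0 := half_plane_neq0 rt.
have pz i : partial_z g V i (fun q => tau_fun (V q) r t) p / tau_fun (V p) r t =
    \sum_(a <- right_seq p) (numq (Omega (V p) a))%:~R *
      (normalized (Zch (V p) a) t * dlog_Lambda (normalized (Zch (V p) a) t) *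
       ((lcoord g a 0 i)%:~R / (2 * pi%:C * 'i * t))).
  have [T0 [_ DT]] := tau_fun_log_derivative i rt nact.
  have sp : period_inv g V p (period g V p) = p.
    have [A [B [_ _ Ap HA _]]] : local_inverse (period g V) p (period_inv g V p).
      exact: (xgetPex (fun=> p) (mini p)).
    by have [] := HA _ Ap.
  move: DT; rewrite sp => DT; rewrite [partial_z _ _ _ _ _]DT mulfK; first by [].
  exact: tau_fun_neq0.
under [RHS]eq_bigr do rewrite pz mulr_sumr.
rewrite exchange_big /= mulr_sumr; apply: eq_bigr => a _.
rewrite (formC skew) (form_coord a) mulrN mulrNz intrM.
have p0 : (pi%:C : C) != 0 by rewrite -cmod_gt0 cmod_real normr_gt0 gt_eqF // pi_gt0.
rewrite (rmorph_sum (intmul (1 : C))) /= mulr_sumr mulNr mulr_suml -sumrN mulr_sumr.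
apply: eq_bigr => i _; rewrite intrM.
move: (normalized _ _) (pi%:C : C) p0 => w P p0.
by field; rewrite t0 p0 neq0Ci.
Qed.

End Tau.

Theorem theorem5p5 (R : realType) (L : zmodType) (n : nat) (g : 'I_n -> L)
    (form : L -> L -> int) (N : 'rV[R]_n -> R)
    (M : complexManifold R) (V : M -> bps R L) :
  zbasis g -> skew_form form -> is_norm N ->
  framed_variation g form N V -> miniversal g V ->
  (forall p, finite_bps (V p)) ->
  (forall p, uncoupled_bps form (V p)) ->
  (forall p, integral_bps (V p)) ->
  is_tau_function g form V
    (fun r b p t => Y_fun form (V p) r b t)
    (fun B r t => tau_fun B r t).
Proof.
move=> gb skew Nn framed mini finV unV _ r [z0 [z00 ->]] p t rt; split.
- exact: tau_fun_neq0.
- exact: (tau_fun_mholo2 gb skew Nn framed mini finV unV z00 rt).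
- by move=> l l0; exact: tau_fun_rescale.
- by move=> nact j; exact: (tau_equation gb skew Nn framed mini finV unV z00 j rt nact).
Qed.
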